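(* Let $p$ be a prime, $d\ge 1$ a natural number, and $\sigma,b$ positive real numbers. Let $\vec Y$ be the product process in $\mathbb{Q}_p^d$ with diffusion constant $\sigma$ and diffusion exponent $b$, and let $\alpha_1=1-\dfrac{p^b-1}{p^{b+1}-1}$. For any integer $R$ and any real $T>0$, $$\left(\otimes^dP\right)\left(\sup_{0\le t\le T}\|\vec Y_t\|\le p^R\right)=e^{-d\,\sigma\,\alpha_1\,T\,p^{-Rb}} .$$
   Context: $|\cdot|$ is the $p$-adic absolute value on $\mathbb{Q}_p$, and $\|\vec x\|=\max_{1\le i\le d}|x_i|$ is the max-norm on $\mathbb{Q}_p^d$. $dy$ denotes the Haar measure on $\mathbb{Q}_p$ giving $\mathbb{Z}_p$ measure 1, and $\chi(x)=e^{2\pi\sqrt{-1}\{x\}}$ is the standard additive character of $\mathbb{Q}_p$, with $\{x\}$ the $p$-adic fractional part. For $t>0$ put $\rho(t,x)=\int_{\mathbb{Q}_p}\chi(xy)\,e^{-\sigma t|y|^b}\,dy$, a probability density on $\mathbb{Q}_p$. $P$ is the probability measure on the Skorohod space $D([0,\infty):\mathbb{Q}_p)$ of càdlàg paths, concentrated on paths starting at $0$, under which increments over disjoint time intervals are independent and $\omega(t)-\omega(s)$, $0\le s<t$, has density $\rho(t-s,\cdot)$ (the law of Brownian motion in $\mathbb{Q}_p$ with diffusion constant $\sigma$ and diffusion exponent $b$). The product process is $\vec Y_t(\omega)=(\omega_1(t),\dots,\omega_d(t))$ for $\omega=(\omega_1,\dots,\omega_d)\in D([0,\infty):\mathbb{Q}_p)^d$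 under the $d$-fold product measure $\otimes^dP$; that is, its components are $d$ independent Brownian motions in $\mathbb{Q}_p$ with law $P$. *)

(* Defs.v *)
From HB Require Import structures.
From mathcomp Require Import all_boot all_order all_algebra.
From mathcomp Require Import generic_quotient ring_quotient zify lra ring.
From mathcomp Require Import complex all_classical all_reals all_analysis.
Set Implicit Arguments.
Unset Strict Implicit.
Unset Printing Implicit Defensive.
Import Order.TTheory GRing.Theory Num.Theory.
Import numFieldNormedType.Exports.
Local Open Scope classical_set_scope.
Local Open Scope ring_scope.
Local Open Scope quotient_scope.

(* The p-adic absolute value on rat. When p is not prime, logn p is identically
   0 and this is the trivial absolute value; hence no primality hypothesis is
   needed in the construction below. *)
Definition pabsq (p : nat) (x : rat) : rat :=
  if x == 0 then 0
  else p%:R ^ ((logn p `|denq x|)%:Z - (logn p `|numq x|)%:Z).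

Section pabsq_theory.
Variable p : nat.
Implicit Types x y : rat.

Lemma pabsq0 : pabsq p 0 = 0. Proof. by rewrite /pabsq eqxx. Qed.

Lemma pabsq_frac (a d : int) : a != 0 -> d != 0 ->
  pabsq p (a%:~R / d%:~R) = p%:R ^ ((logn p `|d|)%:Z - (logn p `|a|)%:Z).
Proof.
move=> a0 d0; have d0' : d%:~R != 0 :> rat by rewrite intr_eq0.
have a0' : a%:~R != 0 :> rat by rewrite intr_eq0.
set x := _ / _; have x0 : x != 0 by rewrite mulf_neq0 ?invr_neq0.
rewrite /pabsq (negbTE x0); congr (_ ^ _).
have E : (numq x * d = a * denq x)%R.
  apply: (@intr_inj rat); rewrite !rmorphM /=.
  by rewrite -[X in X * _](mulfK (_ : (denq x)%:~R != 0)) ?intr_eq0 ?denq_neq0 //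
    numqE mulrAC [x]lock -lock /x; field; rewrite d0' intr_eq0 denq_neq0.
have n0 : numq x != 0 by rewrite numq_eq0.
move: (congr1 (logn p \o absz) E) => /=.
rewrite !abszM !lognM ?absz_gt0 ?denq_neq0 //; lia.
Qed.

Lemma pabsq_nprime x : ~~ prime p -> pabsq p x = (x != 0)%:R.
Proof.
move=> np; rewrite /pabsq; case: eqP => //= _.
by rewrite /logn (negbTE np) subrr expr0z.
Qed.

Lemma ratE x : x = (numq x)%:~R / (denq x)%:~R.
Proof. by rewrite divq_num_den. Qed.

Lemma pabsq_gt0 x : x != 0 -> 0 < pabsq p x.
Proof.
move=> x0; have [pp|np] := boolP (prime p); last by rewrite pabsq_nprime // x0.
by rewrite /pabsq (negbTE x0) exprz_gt0 // ltr0n prime_gt0.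
Qed.

Lemma pabsq_ge0 x : 0 <= pabsq p x.
Proof. by have [->|/pabsq_gt0/ltW//] := eqVneq x 0; rewrite pabsq0. Qed.

Lemma pabsqM x y : pabsq p (x * y) = pabsq p x * pabsq p y.
Proof.
have [->|x0] := eqVneq x 0; first by rewrite mul0r pabsq0 mul0r.
have [->|y0] := eqVneq y 0; first by rewrite mulr0 pabsq0 mulr0.
have [pp|np] := boolP (prime p); last first.
  by rewrite !pabsq_nprime // mulf_neq0 // x0 y0 mulr1.
have p0 : p%:R != 0 :> rat by rewrite pnatr_eq0 -lt0n prime_gt0.
have := denq_neq0 x; have := denq_neq0 y => dy dx.
rewrite [in LHS](ratE x) [in LHS](ratE y) mulf_div -!intrM.
rewrite pabsq_frac ?mulf_neq0 ?numq_eq0 //.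
rewrite /pabsq (negbTE x0) (negbTE y0) -expfzDr //; congr (_ ^ _).
rewrite !abszM !lognM ?absz_gt0 ?numq_eq0 //; lia.
Qed.

Lemma pabsqN x : pabsq p (- x) = pabsq p x.
Proof. by rewrite /pabsq oppr_eq0 numqN denqN abszN. Qed.

Lemma pabsqD x y : pabsq p (x + y) <= Num.max (pabsq p x) (pabsq p y).
Proof.
have [->|x0] := eqVneq x 0; first by rewrite add0r le_max lexx orbT.
have [->|y0] := eqVneq y 0; first by rewrite addr0 le_max lexx.
have [->|xy0] := eqVneq (x + y) 0; first by rewrite pabsq0 le_max pabsq_ge0.
have [pp|np] := boolP (prime p); last first.
  by rewrite !pabsq_nprime // x0 y0 xy0 le_max lexx.
have p1 : 1 <= p%:R :> rat by rewrite ler1n prime_gt0.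
pose d := denq x * denq y; pose a := numq x * denq y; pose b := numq y * denq x.
have dx := denq_neq0 x; have dy := denq_neq0 y.
have d0 : d != 0 by rewrite mulf_neq0.
have dx' : (denq x)%:~R != 0 :> rat by rewrite intr_eq0.
have dy' : (denq y)%:~R != 0 :> rat by rewrite intr_eq0.
have xE : x = a%:~R / d%:~R.
  by rewrite /a /d !intrM {1}(ratE x); field; rewrite dx' dy'.
have yE : y = b%:~R / d%:~R.
  by rewrite /b /d !intrM {1}(ratE y); field; rewrite dx' dy'.
have a0 : a != 0 by rewrite mulf_neq0 ?numq_eq0.
have b0 : b != 0 by rewrite mulf_neq0 ?numq_eq0.
have xyE : x + y = (a + b)%:~R / d%:~R by rewrite intrD mulrDl -xE -yE.
have ab0 : a + b != 0.
  by apply: contra_neq xy0 => ab; rewrite xyE ab mul0r.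
rewrite xyE {1}xE {1}yE !pabsq_frac //.
set m := minn (logn p `|a|) (logn p `|b|).
have ma : (p ^ m %| `|a|)%N by rewrite pfactor_dvdn ?absz_gt0 // geq_minl.
have mb : (p ^ m %| `|b|)%N by rewrite pfactor_dvdn ?absz_gt0 // geq_minr.
have mab : (m <= logn p (absz (a + b)%R))%N.
  rewrite -pfactor_dvdn ?absz_gt0 //.
  have : ((p ^ m)%:Z %| a + b)%Z by rewrite rpredD // dvdzE.
  by rewrite dvdzE.
rewrite le_max; case: (leqP (logn p `|a|) (logn p `|b|)) => H; apply/orP;
  [left|right]; apply: ler_weXz2l => //; move: mab; rewrite /m; lia.
Qed.

Lemma pabsq_triangle x y : pabsq p (x + y) <= pabsq p x + pabsq p y.
Proof.
apply: le_trans (pabsqD x y) _.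
by rewrite ge_max lerDl lerDr !pabsq_ge0.
Qed.

Lemma pabsq_dist x y : `|pabsq p x - pabsq p y| <= pabsq p (x - y).
Proof.
rewrite ler_distl; apply/andP; split.
  have := pabsq_triangle (- (x - y)) x.
  by rewrite pabsqN opprB subrK lerBlDl.
by have := pabsq_triangle (x - y) y; rewrite subrK addrC.
Qed.

Lemma pabsq1 : pabsq p 1 = 1.
Proof. by rewrite /pabsq oner_eq0 /= !logn1 subrr expr0z. Qed.

Lemma pabsqV x : pabsq p x^-1 = (pabsq p x)^-1.
Proof.
have [->|x0] := eqVneq x 0; first by rewrite !(invr0, pabsq0).
apply: (mulfI (lt0r_neq0 (pabsq_gt0 x0))).
by rewrite -pabsqM !mulfV ?pabsq1 // lt0r_neq0 // pabsq_gt0.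
Qed.

Lemma pabsqB x y z : pabsq p (x - z) <= Num.max (pabsq p (x - y)) (pabsq p (y - z)).
Proof. by have := pabsqD (x - y) (y - z); rewrite addrA subrK. Qed.
End pabsq_theory.

Definition padic_cauchy (p : nat) (u : nat -> rat) : Prop :=
  forall e : rat, 0 < e -> exists N : nat, forall m n : nat,
    (N <= m)%N -> (N <= n)%N -> pabsq p (u m - u n) < e.

Definition padic_null (p : nat) (u : nat -> rat) : Prop :=
  forall e : rat, 0 < e -> exists N : nat, forall n : nat,
    (N <= n)%N -> pabsq p (u n) < e.

Definition cauchy_pred (p : nat) : {pred nat -> rat} :=
  fun u => `[< padic_cauchy p u >].

Section cauchy_theory.
Variable p : nat.
Implicit Types u v : nat -> rat.

Lemma cauchy_predP u : reflect (padic_cauchy p u) (u \in cauchy_pred p).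
Proof. exact: asboolP. Qed.

Lemma cauchy_bounded u : padic_cauchy p u ->
  exists2 M : rat, 0 < M & forall n, pabsq p (u n) <= M.
Proof.
move=> /(_ 1 ltr01) [N HN].
have S0 k : 0 <= \sum_(i < k) pabsq p (u i).
  by apply: sumr_ge0 => i _; exact: pabsq_ge0.
exists (1 + \sum_(i < N.+1) pabsq p (u i)); first by rewrite ltr_pwDl.
move=> n; have [nN|Nn] := leqP n N.
  rewrite (bigD1 (inord n)) //= inordK // addrCA lerDl addr_ge0 //.
  by apply: sumr_ge0 => i _; exact: pabsq_ge0.
have := pabsq_triangle p (u n - u N) (u N); rewrite subrK => /le_trans; apply.
apply: lerD; first by apply/ltW/HN => //; exact: ltnW.
by rewrite big_ord_recr /= lerDr S0.
Qed.

Lemma null_cauchy u : padic_null p u -> padic_cauchy p u.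
Proof.
move=> H e /H[N HN]; exists N => m n Nm Nn.
by rewrite (le_lt_trans (pabsqD _ _ _)) // gt_max pabsqN !HN.
Qed.

Lemma nullB u v : padic_null p u -> padic_null p v -> padic_null p (u - v).
Proof.
move=> Hu Hv e e0; have [N HN] := Hu e e0; have [M HM] := Hv e e0.
exists (maxn N M) => n; rewrite geq_max => /andP[Nn Mn].
by rewrite (le_lt_trans (pabsqD _ _ _)) // gt_max pabsqN HN //= HM.
Qed.

Lemma nullM u v : padic_cauchy p u -> padic_null p v -> padic_null p (u * v).
Proof.
move=> /cauchy_bounded[M M0 HM] Hv e e0.
have [N HN] := Hv (e / M) (divr_gt0 e0 M0); exists N => n /HN.
rewrite ltr_pdivlMr // mulrC => /(le_lt_trans _); apply.
by rewrite [X in pabsq p X]/GRing.mul/= pabsqM ler_wpM2r ?pabsq_ge0.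
Qed.

Lemma null0 : padic_null p 0.
Proof. by move=> e e0; exists 0%N => n _; rewrite pabsq0. Qed.

Lemma null1 : ~ padic_null p 1.
Proof. by move=> /(_ 1 ltr01)[N /(_ N (leqnn _))]; rewrite pabsq1 ltxx. Qed.

Lemma cauchy_cst (r : rat) : padic_cauchy p (fun=> r).
Proof. by move=> e e0; exists 0%N => m n _ _; rewrite subrr pabsq0. Qed.

Lemma cauchy_subring : subring_closed (cauchy_pred p).
Proof.
split; first exact/cauchy_predP/cauchy_cst.
  move=> u v /cauchy_predP Hu /cauchy_predP Hv; apply/cauchy_predP => e e0.
  have [N HN] := Hu e e0; have [M HM] := Hv e e0.
  exists (maxn N M) => m n; rewrite !geq_max => /andP[Nm Mm] /andP[Nn Mn].
  have -> : (u - v) m - (u - v) n = (u m - u n) - (v m - v n).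
    change ((u m - v m) - (u n - v n) = (u m - u n) - (v m - v n)); ring.
  by rewrite (le_lt_trans (pabsqD _ _ _)) // gt_max pabsqN HN //= HM.
move=> u v /cauchy_predP Hu /cauchy_predP Hv; apply/cauchy_predP => e e0.
have [K K0 HK] := cauchy_bounded Hu; have [L L0 HL] := cauchy_bounded Hv.
have [N HN] := Hu (e / L) (divr_gt0 e0 L0).
have [M HM] := Hv (e / K) (divr_gt0 e0 K0).
exists (maxn N M) => m n; rewrite !geq_max => /andP[Nm Mm] /andP[Nn Mn].
have -> : (u * v) m - (u * v) n = u m * (v m - v n) + (u m - u n) * v n.
  by rewrite mulrBr mulrBl addrA subrK.
rewrite (le_lt_trans (pabsqD _ _ _)) // gt_max !pabsqM; apply/andP; split.
  have := HM _ _ Mm Mn; rewrite ltr_pdivlMr // mulrC => /(le_lt_trans _); apply.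
  by rewrite ler_wpM2r ?pabsq_ge0.
have := HN _ _ Nm Nn; rewrite ltr_pdivlMr // => /(le_lt_trans _); apply.
by rewrite ler_wpM2l ?pabsq_ge0.
Qed.

Lemma cauchy_nonnull u : padic_cauchy p u -> ~ padic_null p u ->
  exists2 c : rat, 0 < c & exists N, forall n, (N <= n)%N -> pabsq p (u n) = c.
Proof.
move=> Hu; rewrite /padic_null -existsNE => -[e]; rewrite not_implyE => -[e0].
rewrite -forallNE => He; have [N HN] := Hu e e0.
have /existsNP[k] := He N; rewrite not_implyE => -[Nk /negP]; rewrite -leNgt => ek.
have ck : 0 < pabsq p (u k) by exact: lt_le_trans ek.
exists (pabsq p (u k)) => //; exists N => n Nn; apply/le_anti/andP; split.
  have := pabsqD p (u n - u k) (u k); rewrite subrK => /le_trans; apply.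
  by rewrite ge_max lexx andbT (le_trans (ltW (HN _ _ Nn Nk))).
have := pabsqD p (u k - u n) (u n); rewrite subrK le_max => /orP[|//].
by move=> /le_lt_trans/(_ (HN _ _ Nk Nn)); rewrite ltNge ek.
Qed.

Lemma cauchy_inv u : padic_cauchy p u -> ~ padic_null p u ->
  exists2 v, padic_cauchy p v & padic_null p (v * u - 1).
Proof.
move=> Hu nu; have [c c0 [N HN]] := cauchy_nonnull Hu nu.
have un0 n : (N <= n)%N -> u n != 0.
  by move=> /HN; apply: contra_eq_neq => ->; rewrite pabsq0 lt_eqF.
exists (fun n => (u n)^-1).
  move=> e e0; have [M HM] := Hu (e * c * c) (mulr_gt0 (mulr_gt0 e0 c0) c0).
  exists (maxn N M) => m n; rewrite !geq_max => /andP[Nm Mm] /andP[Nn Mn].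
  have -> : (u m)^-1 - (u n)^-1 = (u n - u m) * (u m)^-1 * (u n)^-1.
    by field; rewrite !un0.
  rewrite !pabsqM !pabsqV !HN // !ltr_pdivrMr //; exact: HM.
move=> e e0; exists N => n Nn.
have -> : ((fun n => (u n)^-1) * u - 1) n = (u n)^-1 * u n - 1 by [].
by rewrite mulVf ?un0 // subrr pabsq0.
Qed.
End cauchy_theory.

HB.instance Definition _ (p : nat) :=
  GRing.isSubringClosed.Build (nat -> rat) (cauchy_pred p) (cauchy_subring p).

Record cauchy_seq (p : nat) : Type :=
  CauchySeq { cseq :> nat -> rat ; _ : cseq \in cauchy_pred p }.
HB.instance Definition _ (p : nat) := [isSub for @cseq p].
HB.instance Definition _ (p : nat) := [Choice of cauchy_seq p by <:].
HB.instance Definition _ (p : nat) :=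
  [SubChoice_isSubComNzRing of cauchy_seq p by <:].

Definition null_pred (p : nat) : {pred cauchy_seq p} :=
  fun u => `[< padic_null p u >].
Arguments null_pred : clear implicits.

Section null_ideal.
Variable p : nat.

Lemma null_predP (u : cauchy_seq p) :
  reflect (padic_null p u) (u \in null_pred p).
Proof. exact: asboolP. Qed.

Lemma cseq_cauchy (u : cauchy_seq p) : padic_cauchy p u.
Proof. by apply/cauchy_predP; case: u. Qed.

Lemma null_zmod_closed : zmod_closed (null_pred p).
Proof.
split; first exact/null_predP/null0.
by move=> u v /null_predP Hu /null_predP Hv; apply/null_predP/nullB.
Qed.

Lemma null_proper_ideal : 1 \notin null_pred p /\
  forall u v, v \in null_pred p -> u * v \in null_pred p.
Proof.
split; first by apply/null_predP; exact: null1.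
by move=> u v /null_predP Hv; apply/null_predP/nullM => //; exact: cseq_cauchy.
Qed.
End null_ideal.

HB.instance Definition _ (p : nat) :=
  GRing.isZmodClosed.Build (cauchy_seq p) (null_pred p) (null_zmod_closed p).
HB.instance Definition _ (p : nat) :=
  isProperIdeal.Build (cauchy_seq p) (null_pred p) (null_proper_ideal p).

(* Q_p is the completion of rat for pabsq p: Cauchy sequences modulo null
   sequences. *)
Definition Qp (p : nat) : Type := {ideal_quot (null_pred p)}.
HB.instance Definition _ (p : nat) := Choice.on (Qp p).
HB.instance Definition _ (p : nat) := GRing.ComNzRing.on (Qp p).
HB.instance Definition _ (p : nat) := EqQuotient.on (Qp p).

(* Convergence in rat for the usual (archimedean) order. *)
Definition rat_lim (s : nat -> rat) (a : rat) : Prop :=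
  forall e : rat, 0 < e -> exists N : nat, forall n : nat,
    (N <= n)%N -> `|s n - a| < e.

(* The p-adic absolute value takes rational values on all of Q_p: a non-null
   Cauchy sequence has eventually constant absolute value. *)
Definition Qp_abs (p : nat) (x : Qp p) : rat :=
  xget 0 [set a | rat_lim (fun n => pabsq p (repr x n)) a].

Section Qp_theory.
Variable p : nat.
Implicit Types (u v : cauchy_seq p) (x y z : Qp p).

Lemma rat_lim_uniq (s : nat -> rat) a b : rat_lim s a -> rat_lim s b -> a = b.
Proof.
move=> Ha Hb; apply/eqP/contraT => ab.
have e0 : 0 < `|a - b| / 2 by rewrite divr_gt0 // normr_gt0 subr_eq0.
have [N HN] := Ha _ e0; have [M HM] := Hb _ e0.
have := ltrD (HN _ (leq_maxl N M)) (HM _ (leq_maxr N M)).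
by rewrite -splitr ltNge (distrC _ a) ler_distD.
Qed.

Lemma abs_lim_ex u : exists a, rat_lim (fun n => pabsq p (u n)) a.
Proof.
have [nu|nu] := pselect (padic_null p u).
  exists 0 => e /nu[N HN]; exists N => n /HN.
  by rewrite subr0 ger0_norm ?pabsq_ge0.
have [c c0 [N HN]] := cauchy_nonnull (@cseq_cauchy _ u) nu.
by exists c => e e0; exists N => n /HN ->; rewrite subrr normr0.
Qed.

Lemma pi_eqP u v : \pi_(Qp p) u = \pi_(Qp p) v <-> padic_null p (u - v : cauchy_seq p).
Proof.
split=> [/eqP|H]; last apply/eqP.
  by rewrite -Quotient.idealrBE => /null_predP.
by rewrite -Quotient.idealrBE; apply/null_predP.
Qed.

Lemma Qp_abs_lim u : rat_lim (fun n => pabsq p (u n)) (Qp_abs (\pi_(Qp p) u)).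
Proof.
rewrite /Qp_abs; set v := repr _.
have vu : padic_null p (v - u : cauchy_seq p) by apply/pi_eqP; rewrite reprK.
have [a Ha] := abs_lim_ex v; have [c Hc] := abs_lim_ex u.
case: xgetP => [b _ Hb|/(_ a)//]; suff -> : b = c by [].
apply: rat_lim_uniq Hb _ => e e0.
have e2 : 0 < e / 2 by rewrite divr_gt0.
have [N HN] := vu _ e2; have [M HM] := Hc _ e2.
exists (maxn N M) => n; rewrite geq_max => /andP[Nn Mn].
apply: le_lt_trans (ler_distD (pabsq p (u n)) _ _) _.
rewrite (splitr e) ltrD ?HM //.
exact: le_lt_trans (pabsq_dist _ _ _) (HN _ Nn).
Qed.

Lemma Qp_absE u a : rat_lim (fun n => pabsq p (u n)) a ->
  Qp_abs (\pi_(Qp p) u) = a.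
Proof. exact/rat_lim_uniq/Qp_abs_lim. Qed.

Lemma Qp_abs_ge0 x : 0 <= Qp_abs x.
Proof.
rewrite -[x]reprK leNgt; apply/negP => x0; have := x0; rewrite -oppr_gt0.
move=> /(Qp_abs_lim (repr x))[N /(_ N (leqnn _))].
by rewrite ltr_distl addrN => /andP[_]; rewrite ltNge pabsq_ge0.
Qed.

Lemma Qp_abs_eq0 x : (Qp_abs x == 0) = (x == 0).
Proof.
rewrite -[x]reprK; move: (repr x) => u.
have nuP : rat_lim (fun n => pabsq p (u n)) 0 <-> padic_null p u.
  split=> H e /H[N HN]; exists N => n /HN.
    by rewrite subr0 ger0_norm ?pabsq_ge0.
  by rewrite subr0 ger0_norm ?pabsq_ge0.
have pi0 : \pi_(Qp p) 0 = 0 by rewrite piE.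
apply/eqP/eqP => [H|].
  rewrite -pi0; apply/pi_eqP; rewrite subr0; apply/nuP.
  by rewrite -H; exact: Qp_abs_lim.
by rewrite -pi0 => /pi_eqP; rewrite subr0 => /nuP/Qp_absE.
Qed.

Lemma Qp_absN x : Qp_abs (- x) = Qp_abs x.
Proof.
rewrite -[x]reprK; move: (repr x) => u.
have -> : - \pi_(Qp p) u = \pi_(Qp p) (- u) by rewrite piE.
apply: Qp_absE => e e0; have [N HN] := Qp_abs_lim u e0.
by exists N => n /HN; rewrite [(- u) n]/(- u n) pabsqN.
Qed.

Lemma Qp_absD x y : Qp_abs (x + y) <= Num.max (Qp_abs x) (Qp_abs y).
Proof.
rewrite -[x]reprK -[y]reprK; move: (repr x) (repr y) => u v.
have -> : \pi_(Qp p) u + \pi_(Qp p) v = \pi_(Qp p) (u + v) by rewrite piE.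
set a := Qp_abs (\pi u); set b := Qp_abs (\pi v); set c := Qp_abs _.
rewrite leNgt; apply/negP => mc.
have e0 : 0 < (c - Num.max a b) / 2 by rewrite divr_gt0 // subr_gt0.
set e := _ / 2 in e0.
have [N1 H1] := Qp_abs_lim u e0; have [N2 H2] := Qp_abs_lim v e0.
have [N3 H3] := Qp_abs_lim (u + v) e0.
pose n := maxn N1 (maxn N2 N3).
have {}H1 : pabsq p (u n) < a + e.
  by have := H1 n (leq_maxl _ _); rewrite ltr_distl => /andP[].
have {}H2 : pabsq p (v n) < b + e.
  have := H2 n; rewrite /n leq_max leq_maxl orbT => /(_ isT).
  by rewrite ltr_distl => /andP[].
have {}H3 : c - e < pabsq p (u n + v n).
  have := H3 n; rewrite /n leq_max leq_maxr orbT => /(_ isT).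
  by rewrite ltr_distl => /andP[].
have := lt_le_trans H3 (pabsqD p (u n) (v n)); apply/negP; rewrite -leNgt.
have ce : c - e = Num.max a b + e by rewrite /e; lra.
rewrite ce ge_max (le_trans (ltW H1)) ?lerD2r ?le_max ?lexx //=.
by rewrite (le_trans (ltW H2)) // lerD2r le_max lexx orbT.
Qed.

Lemma Qp_abs_eventually u : Qp_abs (\pi_(Qp p) u) != 0 -> exists N, forall n,
  (N <= n)%N -> pabsq p (u n) = Qp_abs (\pi_(Qp p) u).
Proof.
rewrite Qp_abs_eq0 => u0.
have nu : ~ padic_null p u.
  move=> nu; case/eqP: u0; rewrite [RHS](_ : 0 = \pi_(Qp p) 0) ?piE //.
  by apply/pi_eqP; rewrite subr0.
have [c c0 [N HN]] := cauchy_nonnull (@cseq_cauchy _ u) nu.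
exists N => n Nn; rewrite HN //; apply/esym/Qp_absE => e e0.
by exists N => m Nm; rewrite HN // subrr normr0.
Qed.

Lemma Qp_absM x y : Qp_abs (x * y) = Qp_abs x * Qp_abs y.
Proof.
have [/eqP|x0] := eqVneq (Qp_abs x) 0.
  rewrite Qp_abs_eq0 => /eqP ->; rewrite mul0r.
  by rewrite (_ : Qp_abs 0 = 0) ?mul0r //; apply/eqP; rewrite Qp_abs_eq0.
have [/eqP|y0] := eqVneq (Qp_abs y) 0.
  rewrite Qp_abs_eq0 => /eqP ->; rewrite mulr0.
  by rewrite (_ : Qp_abs 0 = 0) ?mulr0 //; apply/eqP; rewrite Qp_abs_eq0.
rewrite -[x]reprK -[y]reprK in x0 y0 *.
move: (repr x) (repr y) x0 y0 => u v u0 v0.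
have -> : \pi_(Qp p) u * \pi_(Qp p) v = \pi_(Qp p) (u * v) by rewrite piE.
have [N HN] := Qp_abs_eventually u0; have [M HM] := Qp_abs_eventually v0.
apply: Qp_absE => e e0; exists (maxn N M) => n; rewrite geq_max => /andP[Nn Mn].
by rewrite [(u * v) n]/(u n * v n) pabsqM HN // HM // subrr normr0.
Qed.

Lemma Qp_mul_ex x : x != 0 -> exists y, y * x = 1.
Proof.
rewrite -[x]reprK; move: (repr x) => u u0.
have nu : ~ padic_null p u.
  move=> nu; case/eqP: u0; rewrite [RHS](_ : 0 = \pi_(Qp p) 0) ?piE //.
  by apply/pi_eqP; rewrite subr0.
have [v /cauchy_predP cv Hv] := cauchy_inv (@cseq_cauchy _ u) nu.
exists (\pi_(Qp p) (CauchySeq cv)).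
transitivity (\pi_(Qp p) (CauchySeq cv * u)); first by rewrite piE.
by rewrite [RHS](_ : 1 = \pi_(Qp p) 1) ?piE //; apply/pi_eqP.
Qed.

Definition Qp_inv x : Qp p := if x == 0 then 0 else xget 0 [set y | y * x = 1].

Lemma Qp_mulVf x : x != 0 -> Qp_inv x * x = 1.
Proof.
move=> x0; rewrite /Qp_inv (negbTE x0); have [y yx] := Qp_mul_ex x0.
by case: xgetP => [z _ //|/(_ y)].
Qed.

Lemma Qp_inv0 : Qp_inv 0 = 0. Proof. by rewrite /Qp_inv eqxx. Qed.

Lemma Qp_abs0 : Qp_abs (0 : Qp p) = 0.
Proof. by apply/eqP; rewrite Qp_abs_eq0. Qed.

Lemma Qp_distxx x : Qp_abs (x - x) = 0.
Proof. by rewrite subrr Qp_abs0. Qed.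

Lemma Qp_dist_eq0 x y : Qp_abs (x - y) = 0 -> x = y.
Proof. by move/eqP; rewrite Qp_abs_eq0 subr_eq0 => /eqP. Qed.

Lemma Qp_distC x y : Qp_abs (x - y) = Qp_abs (y - x).
Proof. by rewrite -Qp_absN opprB. Qed.

Lemma Qp_dist_triangle y x z :
  Qp_abs (x - z) <= Qp_abs (x - y) + Qp_abs (y - z).
Proof.
have := Qp_absD (x - y) (y - z); rewrite addrA subrK => /le_trans; apply.
by rewrite ge_max lerDl lerDr !Qp_abs_ge0.
Qed.
End Qp_theory.

HB.instance Definition _ (p : nat) :=
  GRing.ComNzRing_isField.Build (Qp p) (@Qp_mulVf p) (@Qp_inv0 p).
HB.instance Definition _ (p : nat) := isPointed.Build (Qp p) 0.
HB.instance Definition _ (p : nat) := isMetric.Build rat (Qp p)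
  (@Qp_distxx p) (@Qp_dist_eq0 p) (@Qp_distC p) (@Qp_dist_triangle p).
HB.instance Definition _ (p : nat) :=
  @isMeasurable.Build (sigma_display (@open (Qp p))) (Qp p)
    <<s @open (Qp p) >> (@sigma_algebra0 _ setT (@open (Qp p)))
    (@sigma_algebraC _ (@open (Qp p)))
    (@sigma_algebra_bigcup _ setT (@open (Qp p))).

Definition Qp_of_rat (p : nat) (r : rat) : Qp p :=
  \pi_(Qp p) (CauchySeq (introT (cauchy_predP p _) (@cauchy_cst p r))).

Lemma Qp_abs_rat (p : nat) (r : rat) : Qp_abs (Qp_of_rat p r) = pabsq p r.
Proof.
by apply: Qp_absE => e e0; exists 0%N => n _ /=; rewrite subrr normr0.
Qed.

Definition padic_norm (R : realType) (p : nat) (x : Qp p) : R :=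
  ratr (Qp_abs x).

Definition max_norm (R : realType) (p d : nat) (x : 'rV[Qp p]_d) : R :=
  \big[Num.max/0]_(i < d) padic_norm R (x 0 i).

(* {x} is the unique r in Z[1/p] with 0 <= r < 1 and x - r in Z_p; a rational
   is in Z[1/p] iff its reduced denominator is a power of p. *)
Definition padic_frac (p : nat) (x : Qp p) : rat :=
  xget 0 [set r : rat | [/\ 0 <= r < 1,
                            exists k : nat, denq r = (p ^ k)%N
                          & Qp_abs (x - Qp_of_rat p r) <= 1]].

Definition padic_char (R : realType) (p : nat) (x : Qp p) : R[i] :=
  let theta : R := 2 * pi * ratr (padic_frac x) in
  (cos theta +i* sin theta)%C.

(* Translation invariance and mass 1 on the compact open set Z_p determine mu
   on the Borel sets, and make it locally finite. *)
Definition is_haar (R : realType) (p : nat)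
    (mu : {measure set (Qp p) -> \bar R}) : Prop :=
  (forall (a : Qp p) (A : set (Qp p)), measurable A ->
     mu [set a + x | x in A] = mu A) /\
  mu [set x | padic_norm R x <= 1] = 1%E.

Definition complex_integral d (T : measurableType d) (R : realType)
    (mu : {measure set T -> \bar R}) (D : set T) (f : T -> R[i]) : R[i] :=
  (\int[mu]_(x in D) complex.Re (f x) +i* \int[mu]_(x in D) complex.Im (f x))%C.

Definition heat_kernel (R : realType) (p : nat)
    (mu : {measure set (Qp p) -> \bar R}) (sigma b t : R) (x : Qp p) : R[i] :=
  complex_integral mu setT (fun y =>
    padic_char R (x * y) * (expR (- (sigma * t * padic_norm R y `^ b)))%:C%C).

Lemma max0_ge0 (R : realType) (s : R) : 0 <= Num.max 0 s.
Proof. by rewrite le_max lexx. Qed.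

(* Extending a path to negative times by its value at 0 lets the one-sided
   limits be taken along the filters t^'+ and t^'- of R. *)
Definition extend_path (R : realType) (p : nat) (w : {nonneg R} -> Qp p)
  (s : R) : Qp p := w (NngNum (max0_ge0 s)).

Definition cadlag (R : realType) (p : nat) (w : {nonneg R} -> Qp p) : Prop :=
  forall t : {nonneg R},
    extend_path w s @[s --> (t%:num)^'+] --> w t /\
    (0 < t%:num ->
     exists l : Qp p, extend_path w s @[s --> (t%:num)^'-] --> l).

Record skorohod (R : realType) (p : nat) : Type := Skorohod {
  path :> {nonneg R} -> Qp p ;
  path_cadlag : cadlag path }.

Lemma cadlag0 (R : realType) (p : nat) : @cadlag R p (fun=> 0).
Proof. by move=> t; split=> [|_]; [|exists 0]; exact: cvg_cst. Qed.

HB.instance Definition _ (R : realType) (p : nat) :=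
  gen_eqMixin (skorohod R p).
HB.instance Definition _ (R : realType) (p : nat) :=
  gen_choiceMixin (skorohod R p).
HB.instance Definition _ (R : realType) (p : nat) :=
  isPointed.Build (skorohod R p) (Skorohod (@cadlag0 R p)).

(* The sigma-algebra on the path space is the one generated by the coordinate
   maps, i.e. the Borel sigma-algebra of the Skorohod topology. *)
Definition cylinders (R : realType) (p : nat) : set (set (skorohod R p)) :=
  [set C | exists (t : {nonneg R}) (B : set (Qp p)),
     measurable B /\ C = [set w : skorohod R p | B (w t)]].

HB.instance Definition _ (R : realType) (p : nat) :=
  @isMeasurable.Build (sigma_display (@cylinders R p)) (skorohod R p)
    <<s @cylinders R p >> (@sigma_algebra0 _ setT (@cylinders R p))
    (@sigma_algebraC _ (@cylinders R p))
    (@sigma_algebra_bigcup _ setT (@cylinders R p)).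

(* Taking some of the B i to be setT yields the product rule for subfamilies. *)
Definition mutually_independent d d' (T : measurableType d)
    (U : measurableType d') (R : realType) (P : probability T R) (n : nat)
    (X : 'I_n -> T -> U) : Prop :=
  forall B : 'I_n -> set U, (forall i, measurable (B i)) ->
    P (\bigcap_i X i @^-1` B i) = (\prod_(i < n) P (X i @^-1` B i))%E.

Definition increment (R : realType) (p : nat) (s t : {nonneg R})
  (w : skorohod R p) : Qp p := w t - w s.

(* Two intervals may share an endpoint. The density heat_kernel is written as a
   complex integral, so the law of an increment is stated in R[i]. *)
Record is_brownian (R : realType) (p : nat)
    (mu : {measure set (Qp p) -> \bar R}) (sigma b : R)
    (P : probability (skorohod R p) R) : Prop := IsBrownian {
  brownian_start : P [set w : skorohod R p | w 0%:nng = 0] = 1%E ;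
  brownian_indep : forall (n : nat) (s t : 'I_n -> {nonneg R}),
    (forall i, (s i)%:num < (t i)%:num) ->
    (forall i j, i != j ->
       (t i)%:num <= (s j)%:num \/ (t j)%:num <= (s i)%:num) ->
    mutually_independent P (fun i => @increment R p (s i) (t i)) ;
  brownian_law : forall s t : {nonneg R}, s%:num < t%:num ->
    forall A : set (Qp p), measurable A ->
      (fine (P (increment s t @^-1` A)))%:C%C =
      complex_integral mu A (heat_kernel mu sigma b (t%:num - s%:num)) }.

Definition is_power_measure d (T : measurableType d) (R : realType) (n : nat)
    (P : probability T R) (Q : probability (n.-tuple T) R) : Prop :=
  forall A : 'I_n -> set T, (forall i, measurable (A i)) ->
    Q [set x | forall i, A i (tnth x i)] = (\prod_(i < n) P (A i))%E.

Definition product_process (R : realType) (p d : nat) (t : {nonneg R})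
  (w : d.-tuple (skorohod R p)) : 'rV[Qp p]_d := \row_i tnth w i t.

Definition alpha1 (R : realType) (p : nat) (b : R) : R :=
  1 - (p%:R `^ b - 1) / (p%:R `^ (b + 1) - 1).

(* Main.v *)
Require Import Defs.
From mathcomp Require Import all_boot all_order all_algebra.
From mathcomp Require Import generic_quotient zify lra ring.
From mathcomp Require Import all_classical all_reals all_analysis.
From mathcomp Require Import measurable_realfun.
Set Implicit Arguments.
Unset Strict Implicit.
Unset Printing Implicit Defensive.
Import Order.TTheory GRing.Theory Num.Theory.
Import numFieldNormedType.Exports.
Local Open Scope classical_set_scope.
Local Open Scope ring_scope.

(** The event splits over the [d] independent coordinates, so it is enough to
    compute, for one Brownian path [w], the probability that [w] stays in the
    ball [B] of radius [p ^ r] up to time [T] ([confined_prob]).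

    Balls are subgroups by the ultrametric inequality: a path that starts at
    [0] is in [B] at all times [k T / 2 ^ n] if and only if its [2 ^ n]
    successive increments are in [B] ([grid_start]).  The increments are
    independent with the same law, so this event has probability
    [F (T / 2 ^ n) ^+ (2 ^ n)], where [F t] is the mass that the heat kernel at
    time [t] puts on [B] ([grid_confined_prob]).  As [n] grows these events
    decrease to the event of staying in [B] up to [T], because paths are
    right-continuous ([confinedE]).  If [F t = 1 - alpha * t + O(t ^ 2)], the
    limit is [expR (- alpha * T)], and the [d] coordinates together contribute
    its [d]-th power.

    To compute [F t], the radial function [y |-> expR (- (sigma * t * |y| ^ b))]
    is written as a superposition of indicators of balls, with the jumps
    [G n - G (n + 1)] as coefficients, [G n] being its value at [|y| = p ^ n].
    The Fourier transform of the indicator of the ball of radius [p ^ n] is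
    [p ^ n] times the indicator of the ball of radius [p ^ (- n)]
    ([cos_char_integral]).  The real part of the heat kernel is therefore an
    explicit increasing limit of nonnegative step functions ([step_fourier_cvg]),
    which is integrated term by term over [B] ([radial_fourier_ball]).  A
    summation by parts then gives
    [F t = (1 - w) * sum_i w ^ i * expR (- (u * q ^ i))], with [w = p ^ -1],
    [q = p ^ (- b)] and [u = sigma * t * p ^ (- r * b)] ([heat_radial_ball]).
    Expanding the exponentials to first order, [F t] equals
    [1 - u * (1 - w) / (1 - w * q)] up to [u ^ 2], and [(1 - w) / (1 - w * q)]
    is [alpha1] ([mix_near_expR], [mix_mean_alpha1]). *)

(** * Absolute value and fractional part on Q_p *)

Section Qp_arith.
Local Open Scope quotient_scope.
Variable p : nat.
Hypothesis p_prime : prime p.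
Implicit Types x y z : Qp p.

Let p_gt0 : 0 < p%:R :> rat. Proof. by rewrite ltr0n prime_gt0. Qed.
Let p_gt1 : 1 < p%:R :> rat. Proof. by rewrite ltr1n prime_gt1. Qed.
Let p_neq0 : p%:R != 0 :> rat. Proof. by rewrite gt_eqF. Qed.

Lemma Qp_abs_leD x y e : Qp_abs x <= e -> Qp_abs y <= e -> Qp_abs (x + y) <= e.
Proof.
by move=> xe ye; apply: le_trans (Qp_absD _ _) _; rewrite ge_max; apply/andP.
Qed.

Lemma Qp_of_ratB (a b : rat) : Qp_of_rat p (a - b) = Qp_of_rat p a - Qp_of_rat p b.
Proof.
rewrite /Qp_of_rat; set u := CauchySeq _; set v := CauchySeq _; set w := CauchySeq _.
have -> : u = v - w by apply: val_inj.
by rewrite piE.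
Qed.

Lemma Qp_of_ratD (a b : rat) : Qp_of_rat p (a + b) = Qp_of_rat p a + Qp_of_rat p b.
Proof. by apply/eqP; rewrite -subr_eq -Qp_of_ratB addrK. Qed.

Lemma Qp_abs_expz x : x != 0 -> exists k : int, Qp_abs x = p%:R ^ k.
Proof.
rewrite -[x]reprK; move: (repr x) => u; rewrite -Qp_abs_eq0 => u0.
have [N /(_ N (leqnn _)) E] := Qp_abs_eventually u0.
rewrite -E in u0 *; have uN : u N != 0.
  by apply: contra_neq u0 => ->; rewrite pabsq0.
by rewrite /pabsq (negbTE uN); eexists.
Qed.

Lemma Qp_rat_dense x (e : rat) : 0 < e ->
  exists q : rat, Qp_abs (x - Qp_of_rat p q) < e.
Proof.
move=> e0; rewrite -[x]reprK; move: (repr x) => u.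
have e2 : 0 < e / 2 by rewrite divr_gt0.
have [N HN] := @cseq_cauchy p u _ e2.
exists (u N); rewrite /Qp_of_rat; set v := CauchySeq _.
have -> : \pi_(Qp p) u - \pi_(Qp p) v = \pi_(Qp p) (u - v) by rewrite piE.
have [M HM] := Qp_abs_lim (u - v) e2.
have := HM _ (leq_maxl M N); rewrite ltr_distl => /andP[+ _].
have := HN _ _ (leq_maxr M N) (leqnn N).
change (pabsq p (u (maxn M N) - u N) < e / 2 ->
 Qp_abs (\pi_(Qp p) (u - v)) - e / 2 < pabsq p (u (maxn M N) - u N) ->
 Qp_abs (\pi_(Qp p) (u - v)) < e).
lra.
Qed.

Lemma ler_expz_p (m n : int) : (p%:R ^ m <= p%:R ^ n :> rat) = (m <= n).
Proof. exact: ler_eXz2l. Qed.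

Definition is_frac x (r : rat) := [/\ 0 <= r < 1,
  exists k : nat, denq r = (p ^ k)%N & Qp_abs (x - Qp_of_rat p r) <= 1].

Lemma pdenom_frac (r : rat) (k : nat) (c : int) :
  r = c%:~R / (p ^ k)%:R -> exists k : nat, denq r = (p ^ k)%N.
Proof.
move=> rE.
have pk : (0 < p ^ k)%N by rewrite expn_gt0 prime_gt0.
have : (`|denq r| %| p ^ k)%N.
  have E : (numq r * (p ^ k)%N = c * denq r)%R.
    apply: (@intr_inj rat); rewrite !rmorphM /= numqE {1}rE.
    by field; rewrite pnatr_eq0 -lt0n.
  have : (denq r %| numq r * (p ^ k)%N)%Z by rewrite E dvdz_mull.
  rewrite Gauss_dvdzr; first by rewrite dvdzE.
  by rewrite coprimezE coprime_sym coprime_num_den.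
move=> /(dvdn_pfactor _ _ p_prime)[m _ E]; exists m.
by rewrite -E -[LHS]gez0_abs.
Qed.

(** Approximate [x] by a rational [q] and keep only the p-part of [q] in its
    partial fraction decomposition: when the denominator of [q] is [m * p ^ k]
    with [p] not dividing [m], a Bezout relation between [m] and [p ^ k] gives
    the numerator over [p ^ k], and what remains has denominator [m], hence is
    p-adically integral. *)
Lemma frac_exists x : exists r, is_frac x r.
Proof.
have [q] := Qp_rat_dense x ltr01 => Hq.
have d0 : (0 < `|denq q|)%N by rewrite absz_gt0 denq_neq0.
have [m cop dE] := pfactor_coprime p_prime d0.
set k := logn p _ in dE.
have m0 : (0 < m)%N by move: d0; rewrite dE muln_gt0 => /andP[].
have pk : (0 < p ^ k)%N by rewrite expn_gt0 prime_gt0.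
have pkr : (p ^ k)%:R != 0 :> rat by rewrite pnatr_eq0 -lt0n.
have mr : m%:R != 0 :> rat by rewrite pnatr_eq0 -lt0n.
have [u [v uv]] := Bezoutz m (p ^ k)%N.
have {}uv : u * m + v * (p ^ k)%N = 1.
  by rewrite uv /gcdz /=; have := coprimeXl k cop; rewrite coprime_sym => /eqP ->.
(* Reducing modulo [p ^ k] puts the fraction in [0, 1). *)
pose c := numq q * u; pose c' := (c %% (p ^ k)%N)%Z.
have c'0 : 0 <= c' by rewrite modz_ge0 // -lt0n.
have c'1 : c' < (p ^ k)%N by rewrite ltz_pmod.
pose r : rat := c'%:~R / (p ^ k)%:R.
have cE : c = (c %/ (p ^ k)%N)%Z * (p ^ k)%N + c' by rewrite -divz_eq.
pose e : int := numq q * v + (c %/ (p ^ k)%N)%Z * m.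
have qE : q = (numq q)%:~R / (m%:R * (p ^ k)%:R).
  rewrite {1}(ratE q); congr (_ / _).
  by rewrite -natrM -dE natr_absz gtr0_norm // denq_gt0.
have qrE : q - r = e%:~R / m%:~R.
  have E : numq q = e * (p ^ k)%N + c' * m.
    rewrite /e -[LHS]mulr1 -uv; move: cE; rewrite /c -/c' => cE.
    rewrite mulrDr mulrA; rewrite [in X in X * m%:Z]cE; ring.
  rewrite qE /r E !(intrD, intrM) -!pmulrn; field; exact/andP.
exists r; split.
- rewrite /r divr_ge0 ?ler0z ?ler0n //= ltr_pdivrMr ?ltr0n // mul1r.
  by rewrite pmulrn ltr_int.
- exact: pdenom_frac (erefl r).
- have -> : x - Qp_of_rat p r = (x - Qp_of_rat p q) + (Qp_of_rat p (q - r)).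
    by rewrite Qp_of_ratB addrA subrK.
  apply: le_trans (Qp_absD _ _) _; rewrite ge_max ltW //= Qp_abs_rat qrE.
  have [->|e0] := eqVneq e 0; first by rewrite mul0r pabsq0.
  have lm : logn p m = 0%N by rewrite logn_coprime.
  rewrite -[X in _ / X]/((m%:Z)%:~R) (pabsq_frac p e0) ?gt_eqF //=.
  by rewrite -[leRHS](expr0z p%:R) ler_expz_p lm; lia.
Qed.

(** The reason why fractional parts are unique, and additive up to integers: the
    intersection of Z[1/p] with Z_p is Z. *)
Lemma int_of_pdenom (s : rat) (k : nat) :
  (exists c : int, s = c%:~R / (p ^ k)%:R) -> pabsq p s <= 1 ->
  exists c : int, s = c%:~R.
Proof.
move=> [c sE].
have pk : (0 < p ^ k)%N by rewrite expn_gt0 prime_gt0.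
have [c0|c0] := eqVneq c 0; first by exists 0; rewrite sE c0 mul0r.
rewrite sE; have -> : (p ^ k)%:R = ((p ^ k)%N : int)%:~R :> rat by rewrite pmulrn.
rewrite (pabsq_frac p c0) ?gt_eqF // -[leRHS](expr0z p%:R) ler_expz_p.
rewrite lognX logn_prime // eqxx muln1 subr_le0 lez_nat => kc.
have : (p ^ k %| `|c|)%N by rewrite pfactor_dvdn ?absz_gt0.
move=> H; have /dvdzP[e ->] : ((p ^ k)%N%:Z %| c)%Z by rewrite dvdzE.
by exists e; rewrite intrM mulfK // intr_eq0 gt_eqF.
Qed.

Lemma frac_eq_mod_int x r s : is_frac x r ->
  (exists k : nat, denq s = (p ^ k)%N) -> Qp_abs (x - Qp_of_rat p s) <= 1 ->
  exists c : int, s = r + c%:~R.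
Proof.
move=> [_ [k rk] r1] [l sl] s1.
have [||c cE] := @int_of_pdenom (s - r) (k + l).
- exists (numq s * (p ^ k)%N - numq r * (p ^ l)%N).
  rewrite {1}(ratE s) {1}(ratE r) rk sl expnD natrM intrB !intrM -!pmulrn.
  by field; rewrite !pnatr_eq0 -!lt0n !expn_gt0 prime_gt0.
- rewrite -Qp_abs_rat Qp_of_ratB.
  have -> : Qp_of_rat p s - Qp_of_rat p r =
    (x - Qp_of_rat p r) - (x - Qp_of_rat p s) by rewrite opprB [RHS]addrC addrA subrK.
  by apply: le_trans (Qp_absD _ _) _; rewrite Qp_absN ge_max r1.
- by exists c; rewrite -cE addrC subrK.
Qed.

Lemma frac_uniq x r s : is_frac x r -> is_frac x s -> r = s.
Proof.
move=> Hr [s01 sk s1]; have [c sE] := frac_eq_mod_int Hr sk s1.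
case: Hr => r01 _ _; suff c0 : c = 0 by rewrite sE c0 addr0.
have : ((-1)%:~R < c%:~R :> rat) && (c%:~R < 1%:~R :> rat).
  move: r01 s01; rewrite sE mulrN1z mulr1z => /andP[? ?] /andP[? ?].
  by apply/andP; split; lra.
by rewrite !ltr_int; lia.
Qed.

Lemma padic_fracP x : is_frac x (padic_frac x).
Proof.
rewrite /padic_frac; case: xgetP => [r _ //|H].
by have [r] := frac_exists x; move/H.
Qed.

Lemma padic_fracE x r : is_frac x r -> padic_frac x = r.
Proof. exact/frac_uniq/padic_fracP. Qed.

Lemma denq_powD (r s : rat) : (exists k : nat, denq r = (p ^ k)%N) ->
  (exists k : nat, denq s = (p ^ k)%N) -> exists k : nat, denq (r + s) = (p ^ k)%N.
Proof.
move=> [k rk] [l sl].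
apply: (@pdenom_frac _ (k + l) (numq s * (p ^ k)%N + numq r * (p ^ l)%N)).
rewrite {1}(ratE s) {1}(ratE r) rk sl expnD natrM intrD !intrM -!pmulrn.
by field; rewrite !pnatr_eq0 -!lt0n !expn_gt0 prime_gt0.
Qed.

(** The integer [c] is invisible to the functions of period 1: this is the
    additivity of the character. *)
Lemma padic_fracD x y : exists c : int,
  padic_frac x + padic_frac y = padic_frac (x + y) + c%:~R.
Proof.
have [_ xk x1] := padic_fracP x; have [_ yk y1] := padic_fracP y.
apply: (frac_eq_mod_int (padic_fracP (x + y))); first exact: denq_powD.
have -> : x + y - Qp_of_rat p (padic_frac x + padic_frac y) =
  (x - Qp_of_rat p (padic_frac x)) + (y - Qp_of_rat p (padic_frac y)).
  by rewrite Qp_of_ratD opprD addrACA.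
exact: Qp_abs_leD.
Qed.

Lemma Qp_abs_addr x y e : Qp_abs y <= e -> (Qp_abs (x + y) <= e) = (Qp_abs x <= e).
Proof.
move=> ye; apply/idP/idP => H.
  by rewrite -(addrK y x); apply: Qp_abs_leD; rewrite ?Qp_absN.
exact: Qp_abs_leD.
Qed.

(** This is what makes the additive character locally constant, hence
    measurable. *)
Lemma padic_frac_addZp x y : Qp_abs y <= 1 -> padic_frac (x + y) = padic_frac x.
Proof.
move=> y1; apply: padic_fracE; have [? ? x1] := padic_fracP x; split=> //.
by rewrite addrAC Qp_abs_addr.
Qed.

Definition ppow (k : int) : Qp p := Qp_of_rat p (p%:R ^ k).

Lemma Qp_abs_ppow k : Qp_abs (ppow k) = p%:R ^ (- k).
Proof.
rewrite Qp_abs_rat; case: (intP k) => [|n|n].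
- by rewrite expr0z pabsq1.
- have -> : p%:R ^ n.+1 = ((p ^ n.+1)%N : int)%:~R / 1%:~R :> rat.
    by rewrite divr1 -pmulrn natrX.
  rewrite pabsq_frac ?gt_eqF ?ltz_nat ?expn_gt0 ?(prime_gt0 p_prime) //= logn1.
  by rewrite lognX logn_prime // eqxx muln1 sub0r.
- rewrite -invr_expz.
  have -> : (p%:R ^ n.+1)^-1 = 1%:~R / ((p ^ n.+1)%N : int)%:~R :> rat.
    by rewrite mul1r -pmulrn natrX.
  rewrite pabsq_frac ?gt_eqF ?ltz_nat ?expn_gt0 ?(prime_gt0 p_prime) //= logn1.
  by rewrite lognX logn_prime // eqxx muln1 subr0 opprK.
Qed.

Lemma Qp_of_ratM (a b : rat) : Qp_of_rat p (a * b) = Qp_of_rat p a * Qp_of_rat p b.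
Proof.
rewrite /Qp_of_rat; set u := CauchySeq _; set v := CauchySeq _; set w := CauchySeq _.
have -> : u = v * w by apply: val_inj.
by rewrite piE.
Qed.

Lemma ppowD (k l : int) : ppow (k + l) = ppow k * ppow l.
Proof. by rewrite /ppow expfzDr // Qp_of_ratM. Qed.

Lemma ppow0 : ppow 0 = 1.
Proof. by rewrite /ppow expr0z /Qp_of_rat piE; congr \pi_ _; apply: val_inj. Qed.

(** For [j < p] these represent the cosets of the ball of radius [p ^ (k - 1)]
    in the ball of radius [p ^ k]. *)
Definition coset_rep (k : int) (j : nat) : Qp p := Qp_of_rat p (j%:R * p%:R ^ (- k)).

Lemma pabsq_expz (k : int) : pabsq p (p%:R ^ k) = p%:R ^ (- k).
Proof. by rewrite -Qp_abs_rat -/(ppow k) Qp_abs_ppow. Qed.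

(** After scaling to [|z| <= p], the digit is [p] times the fractional part of
    [z]: that number is p-adically integral and lies in Z[1/p], so it is an
    integer. *)
Lemma coset_rep_exists (k : int) x : Qp_abs x <= p%:R ^ k ->
  exists2 j : nat, (j < p)%N & Qp_abs (x - coset_rep k j) <= p%:R ^ (k - 1).
Proof.
move=> xk; pose z := x * ppow (k - 1).
have zp : Qp_abs z <= p%:R.
  rewrite /z Qp_absM Qp_abs_ppow.
  have pE : p%:R = p%:R ^ k * p%:R ^ (- (k - 1)) :> rat.
    by rewrite -expfzDr // opprB addrC subrK.
  by rewrite [leRHS]pE ler_pM2r // exprz_gt0.
have [r01 [l rl] zr] := padic_fracP z; set r := padic_frac z in r01 rl zr.
have rp : pabsq p r <= p%:R.
  rewrite -Qp_abs_rat -[Qp_of_rat p r](subKr z).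
  by rewrite Qp_abs_leD // Qp_absN (le_trans zr) // ltW.
have [||c cE] := @int_of_pdenom (r * p%:R) l.
- exists (numq r * p); rewrite {1}(ratE r) rl intrM -!pmulrn.
  by rewrite mulrAC.
- rewrite pabsqM (pabsq_expz 1) exprN1 -[leRHS](mulfV p_neq0).
  by rewrite ler_pM2r // invr_gt0.
have c0 : 0 <= c.
  rewrite -(ler_int rat) -cE pmulr_lge0 //; by case/andP: r01.
have cp : c < p.
  rewrite -(ltr_int rat) -cE -pmulrn -[ltRHS]mul1r ltr_pM2r //.
  by case/andP: r01.
exists `|c|%N; first by lia.
have rE : r = `|c|%N%:R * p%:R ^ (-1).
  by rewrite natr_absz ger0_norm // -cE exprN1 mulfK.
have -> : x - coset_rep k `|c| = ppow (1 - k) * (z - Qp_of_rat p r).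
  rewrite mulrBr /z mulrCA -ppowD addrA subrK subrr ppow0 mulr1.
  rewrite -Qp_of_ratM rE mulrCA -expfzDr // addrAC subrr add0r.
  by [].
by rewrite Qp_absM Qp_abs_ppow opprB ler_piMr // exprz_ge0 // ltW.
Qed.

Lemma coset_rep_inj (k : int) (i j : nat) : (i < p)%N -> (j < p)%N ->
  Qp_abs (coset_rep k i - coset_rep k j) <= p%:R ^ (k - 1) -> i = j.
Proof.
move=> ip jp; rewrite -Qp_of_ratB -mulrBl Qp_abs_rat pabsqM pabsq_expz opprK.
rewrite expfzDr // mulrC ler_pM2l ?exprz_gt0 // => H.
apply/eqP/negPn/negP => ij; have ij0 : i%:Z - j%:Z != 0 by lia.
move: H; have -> : i%:R - j%:R = (i%:Z - j%:Z)%:~R / 1%:~R :> rat.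
  by rewrite intrB -!pmulrn divr1.
rewrite (pabsq_frac p ij0) // ler_expz_p /= logn1.
have -> : logn p `|i%:Z - j%:Z| = 0%N.
  apply/eqP; rewrite lognE p_prime /=; case: ifP => //= /andP[d0 pd].
  by have := dvdn_leq d0 pd; lia.
by [].
Qed.

Lemma coset_rep_abs (k : int) (j : nat) : Qp_abs (coset_rep k j) <= p%:R ^ k.
Proof.
rewrite Qp_abs_rat pabsqM pabsq_expz opprK.
apply: ler_piMl; first by rewrite exprz_ge0 // ltW.
have [->|j0] := eqVneq j 0%N; first by rewrite pabsq0.
have -> : j%:R = j%:Z%:~R / 1%:~R :> rat by rewrite -pmulrn divr1.
by rewrite pabsq_frac // -[leRHS](expr0z p%:R) ler_expz_p logn1; lia.
Qed.

End Qp_arith.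

(** * Borel sets of Q_p *)

Definition pball (p : nat) (k : int) : set (Qp p) :=
  [set x | Qp_abs x <= p%:R ^ k].

Section Qp_borel.
Variable p : nat.
Hypothesis p_prime : prime p.
Implicit Types x y z : Qp p.

Let p_gt0 : 0 < p%:R :> rat. Proof. by rewrite ltr0n prime_gt0. Qed.
Let pk_gt0 (k : int) : 0 < p%:R ^ k :> rat. Proof. exact: exprz_gt0. Qed.

Lemma Qp_ballE x (e : rat) : ball x e = [set y | Qp_abs (x - y) < e].
Proof. by rewrite ballEmdist. Qed.

Lemma Qp_openP (A : set (Qp p)) :
  open A <-> forall x, A x -> exists2 e : rat, 0 < e &
    forall y, Qp_abs (x - y) < e -> A y.
Proof.
rewrite openE; split=> [H x /H|H x /H[e e0 He]].
- move=> /(@nbhs_ballP rat (Qp p))[e /= e0 He].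
  exists e; first exact: e0.
  by move=> y xy; apply: He; rewrite Qp_ballE.
- apply/(@nbhs_ballP rat (Qp p)); exists e; first exact: e0.
  by move=> y; rewrite Qp_ballE => xy; exact: He xy.
Qed.

Lemma Qp_open_measurable (A : set (Qp p)) : open A -> measurable A.
Proof. by move=> oA; apply: sub_sigma_algebra; exact: oA. Qed.

Lemma loc_const_measurable (T : Type) (f : Qp p -> T) (A : set T) :
  (forall x, exists2 e : rat, 0 < e & forall y, Qp_abs (x - y) < e -> f y = f x) ->
  measurable (f @^-1` A).
Proof.
move=> H; apply: Qp_open_measurable; apply/Qp_openP => x /= Ax.
by have [e e0 He] := H x; exists e => // y /He ->.
Qed.

Lemma Qp_ball_translate_measurable (e : rat) (a : Qp p) : 0 < e ->
  measurable [set x | Qp_abs (x - a) <= e].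
Proof.
move=> e0; apply: Qp_open_measurable; apply/Qp_openP => x /= xa; exists e => // y xy.
have -> : y - a = (x - a) - (x - y) by ring.
by apply: Qp_abs_leD => //; rewrite Qp_absN ltW.
Qed.

Lemma pball_measurable (k : int) : measurable (@pball p k).
Proof.
have := @Qp_ball_translate_measurable (p%:R ^ k) 0 (pk_gt0 k).
by under eq_set do rewrite subr0.
Qed.

Lemma Qp_set1_measurable x : measurable [set x].
Proof.
rewrite -[X in measurable X]setCK; apply: measurableC; apply: Qp_open_measurable; apply/Qp_openP.
move=> y /= xy; exists (Qp_abs (y - x)) => [|z yz].
  by rewrite lt_neqAle Qp_abs_ge0 andbT eq_sym Qp_abs_eq0 subr_eq0; apply/eqP.
by move=> zx; move: yz; rewrite zx ltxx.
Qed.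

Lemma Qp_shift_measurable a : measurable_fun setT (fun x => x + a).
Proof.
apply: (measurability (@open (Qp p))) => // _ [B /Qp_openP oB <-].
rewrite setTI; apply: Qp_open_measurable; apply/Qp_openP => x /= /oB[e e0 He].
exists e => // y xy; apply: He.
by have -> : x + a - (y + a) = x - y by ring.
Qed.

Lemma pball_coset (k : int) : @pball p k =
  \big[setU/set0]_(j < p) [set coset_rep p k j + x | x in pball (k - 1)].
Proof.
rewrite -(bigcup_mkord p (fun j => [set coset_rep p k j + x | x in pball (k - 1)])).
apply/seteqP; split=> [x /=|x /= [j jp [y yk <-]]].
  rewrite /pball /= => /(coset_rep_exists p_prime)[j jp xj]; exists j => //=.
  by exists (x - coset_rep p k j) => //; rewrite addrC subrK.
rewrite /pball /=; apply: Qp_abs_leD; first exact: coset_rep_abs.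
by apply: le_trans yk _; rewrite ler_expz_p //; lia.
Qed.

End Qp_borel.

(** * Haar measure and orthogonality of the characters *)

Section Haar.
Variables (R : realType) (p : nat).
Hypothesis p_prime : prime p.
Variable mu : {measure set (Qp p) -> \bar R}.
Hypothesis mu_haar : is_haar mu.
Implicit Types x y z : Qp p.

Lemma addrset_measurable a (A : set (Qp p)) : measurable A ->
  measurable [set a + x | x in A].
Proof.
move=> mA; have -> : [set a + x | x in A] = (fun x => x + (- a)) @^-1` A.
  apply/seteqP; split=> [_ /= [y Ay <-]|y Ay] /=.
    by rewrite (_ : a + y - a = y) //; ring.
  by exists (y - a) => //; ring.
by rewrite -[X in measurable X]setTI; apply: Qp_shift_measurable.
Qed.

Lemma haar_pballS (k : int) : mu (@pball p k) = (p%:R%:E * mu (@pball p (k - 1)))%E.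
Proof.
rewrite pball_coset //.
pose F (j : nat) := [set coset_rep p k j + x | x in pball (k - 1)] : set (Qp p).
have -> := @measure_semi_additive_ord_I _ _ _ mu F p.
- have muF j : mu (F j) = mu (@pball p (k - 1)).
    by apply: (mu_haar.1); exact: pball_measurable.
  rewrite (eq_bigr (fun=> mu (@pball p (k - 1)))) => [|i _]; last exact: muF.
  by rewrite sumr_const card_ord mule_natl.
- by move=> j _; apply: addrset_measurable; exact: pball_measurable.
- apply/trivIsetP => i j /= ip jp ij; apply/eqP/negPn/negP => /eqP/eqP/set0P.
  move=> [x [[y yk yx] [z zk zx]]]; move/eqP: ij; apply.
  apply: (coset_rep_inj p_prime (k := k) ip jp).
  have -> : coset_rep p k i - coset_rep p k j = z - y.
    by rewrite -[coset_rep p k i](addrK y) yx -zx; ring.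
  by apply: Qp_abs_leD => //; rewrite Qp_absN.
- by apply: bigsetU_measurable => j _; apply: addrset_measurable; exact: pball_measurable.
Qed.

Let pR_gt0 : 0 < p%:R :> R. Proof. by rewrite ltr0n prime_gt0. Qed.
Let pR_neq0 : p%:R != 0 :> R. Proof. by rewrite gt_eqF. Qed.

(** [haar_pballS] determines the measure of all balls from the normalization
    on Z_p, in both directions; going down requires excluding infinite
    values. *)
Lemma haar_pball (k : int) : mu (@pball p k) = (p%:R ^ k)%:E.
Proof.
have mu0 : mu (@pball p 0) = 1%E.
  rewrite -mu_haar.2; congr (mu _); apply/seteqP; split=> x /=;
  by rewrite /pball /= /padic_norm expr0z -(rmorph1 (ratr : rat -> R)) ler_rat.
elim/int_rect: k => [|n IH|n IH]; first by rewrite mu0 expr0z.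
  rewrite haar_pballS; have -> : n.+1%:Z - 1 = n by lia.
  by rewrite IH -EFinM -exprSz.
have := haar_pballS (- n%:Z); have -> : - n%:Z - 1 = - n.+1%:Z by lia.
rewrite IH; case: (mu (pball _)) => [m [E]||]; last 2 first.
- by rewrite gt0_muley ?lte_fin.
- by rewrite gt0_muleNy ?lte_fin.
congr (_%:E); apply: (mulfI pR_neq0); rewrite -E.
have -> : - n%:Z = 1 + - n.+1%:Z by lia.
by rewrite expfzDr // expr1z.
Qed.

(** The ball is stable under translation by its own elements, so the translation
    carries the integral over it to itself. *)
Lemma haar_integral_shift (k : int) (a : Qp p) (f : Qp p -> R) :
  Qp_abs a <= p%:R ^ k -> measurable_fun setT f -> (forall x, `|f x| <= 1) ->
  (\int[mu]_(x in @pball p k) (f (x + a))%:E = \int[mu]_(x in @pball p k) (f x)%:E)%E.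
Proof.
move=> ak mf f1.
have shE : (fun x => x + a) @^-1` @pball p k = @pball p k.
  by apply/seteqP; split=> x; rewrite /pball /= Qp_abs_addr.
have mb := pball_measurable p_prime k.
have msh := @Qp_shift_measurable p a.
have mshf : measurable_fun setT (f \o (fun x => x + a)).
  by apply: measurableT_comp.
have bint (g : Qp p -> R) : measurable_fun setT g -> (forall x, `|g x| <= 1) ->
    mu.-integrable (@pball p k) (EFin \o g).
  move=> mg g1; apply: measurable_bounded_integrable => //.
  - by rewrite haar_pball ltry.
  - exact: measurable_funS mg.
  - exists 1; split => // M M1 x _; exact: le_trans (g1 x) (ltW M1).
have := @integral_pushforward _ _ _ _ R _ msh mu (@pball p k) (EFin \o f).
rewrite shE => <- //=; last 2 first.
- exact/measurable_EFinP.
- by apply: (bint (f \o (fun x => x + a))) => // x; exact: f1.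
apply: eq_measure_integral => A mA _; rewrite /= /pushforward.
have := mu_haar.1 (- a) A mA => <-; congr (mu _).
apply/seteqP; split=> [x Ax|_ [x Ax <-]] /=; last by rewrite addrC addNKr.
by exists (x + a) => //; rewrite addrC addrK.
Qed.

(** The real part of the character [y |-> chi (x * y)]. *)
Definition cos_char (x y : Qp p) : R := cos (2 * pi * ratr (padic_frac (x * y))).

Lemma cos_char_measurable x : measurable_fun setT (cos_char x).
Proof.
move=> _ A mA; rewrite setTI; apply: loc_const_measurable => // y.
have [->|x0] := eqVneq x 0.
  by exists 1; [exact: ltr01 | move=> z _]; rewrite /cos_char (mul0r y) (mul0r z).
have ax : 0 < Qp_abs x by rewrite lt_neqAle Qp_abs_ge0 andbT eq_sym Qp_abs_eq0.
exists (Qp_abs x)^-1; first by rewrite invr_gt0.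
move=> z yz; rewrite /cos_char.
have -> : x * z = x * y + - (x * (y - z)) by ring.
rewrite padic_frac_addZp // Qp_absN Qp_absM.
by rewrite -[leRHS](mulfV (lt0r_neq0 ax)) ler_pM2l // ltW.
Qed.

Lemma cos_addz (c : int) (t : R) : cos (t + 2 * pi * c%:~R) = cos t.
Proof.
have per n s : cos (s + 2 * pi * n%:R) = cos s :> R.
  rewrite -[RHS](periodicn (@cosD2pi R) n) -[pi *+ 2 *+ n]mulr_natr.
  by rewrite -[pi *+ 2]mulr_natl.
case: (intP c) => [|n|n]; first by rewrite mulr0 addr0.
- by rewrite -pmulrn per.
- by rewrite mulrNz -pmulrn mulrN -[LHS](per n.+1) subrK.
Qed.

Lemma cos_charD x y z : cos_char x (y + z) =
  cos (2 * pi * (ratr (padic_frac (x * y)) + ratr (padic_frac (x * z)))).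
Proof.
have [c cE] := padic_fracD p_prime (x * y) (x * z).
by rewrite /cos_char (mulrDr x) -rmorphD /= cE rmorphD /= ratr_int (mulrDr (2 * pi)) cos_addz.
Qed.

(** The symmetric pair of translates avoids any reference to the sine, that is,
    to the imaginary part of the character. *)
Lemma cos_char_shift x a y : 
  cos_char x (y + a) + cos_char x (y - a) = 2 * cos_char x a * cos_char x y.
Proof.
rewrite cos_charD.
have -> : cos_char x (y - a) =
  cos (2 * pi * (ratr (padic_frac (x * y)) - ratr (padic_frac (x * a)))).
  have [c cE] := padic_fracD p_prime (x * (y - a)) (x * a).
  rewrite -(mulrDr x) subrK in cE.
  rewrite /cos_char -[in LHS](addrK (padic_frac (x * a)) (padic_frac _)) cE.
  by rewrite addrAC rmorphD /= rmorphB /= ratr_int (mulrDr (2 * pi)) cos_addz.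
have cosDB (s t : R) : cos (s + t) + cos (s - t) = 2 * cos t * cos s.
  by rewrite cosD cosB; ring.
rewrite (mulrDr (2 * pi)) (mulrBr (2 * pi)); exact: cosDB.
Qed.

Lemma cos_char_pinv x a : x * a = Qp_of_rat p p%:R^-1 ->
  cos_char x a = cos (2 * pi / p%:R).
Proof.
move=> xa; rewrite /cos_char xa; congr (cos (_ * _)).
rewrite (_ : padic_frac _ = p%:R^-1) ?fmorphV ?rmorph_nat //.
apply: padic_fracE => //; split.
- by rewrite invr_ge0 ler0n /= invf_lt1 ?ltr1n ?ltr0n ?prime_gt1 ?prime_gt0.
- by apply: (@pdenom_frac _ p_prime _ 1 1); rewrite expn1 mul1r.
- by rewrite subrr Qp_abs0.
Qed.

Lemma cos_2pi_p_neq1 : cos (2 * pi / p%:R) != 1 :> R.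
Proof.
have -> : 2 * pi / p%:R = (pi / p%:R) *+ 2 :> R by rewrite -mulrA mulr_natl.
rewrite cos_mulr2n cos2sin2.
have : 0 < sin (pi / p%:R) :> R.
  apply: sin_gt0_pi; rewrite divr_gt0 ?pi_gt0 //=.
  rewrite ltr_pdivrMr // ltr_pMr ?pi_gt0 //.
  by rewrite ltr1n prime_gt1.
by move=> s0; apply/negP => /eqP E; have := exprn_gt0 2 s0; lra.
Qed.

Lemma cos_char_eq1 x y : Qp_abs (x * y) <= 1 -> cos_char x y = 1.
Proof.
move=> xy; rewrite /cos_char -[x * y]add0r padic_frac_addZp //.
rewrite (_ : padic_frac 0 = 0) ?rmorph0 ?mulr0 ?cos0 //.
apply: padic_fracE => //; split; first by rewrite lexx ltr01.
  by exists 0%N.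
by rewrite sub0r Qp_absN Qp_abs_rat pabsq0.
Qed.

(** When [|x| > p ^ (- k)], the ball contains an [a] with [x * a = p ^ -1].
    Translating by [a] and [- a] in [cos_char_shift] shows that the integral is
    multiplied by [cos (2 * pi / p)], which is not 1, without changing: it is
    zero.  Otherwise the integrand is 1 on the ball. *)
Lemma cos_char_integral (k : int) x :
  (\int[mu]_(y in @pball p k) (cos_char x y)%:E)%E =
  ((Qp_abs x <= p%:R ^ (- k))%R%:R * p%:R ^ k)%:E.
Proof.
have mb := pball_measurable p_prime k.
have [xk|xk] := boolP (Qp_abs x <= p%:R ^ (- k)).
  rewrite mul1r -haar_pball -(setIid (pball k)) -integral_indic // setIid.
  apply: eq_integral => y /set_mem yk; rewrite cos_char_eq1 ?indicE ?mem_set //.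
  rewrite Qp_absM -[leRHS](expr0z p%:R) -(addNr k) expfzDr //.
    by rewrite ler_pM // Qp_abs_ge0.
  by rewrite pnatr_eq0 -lt0n prime_gt0.
rewrite mul0r.
have x0 : x != 0.
  by apply: contraNneq xk => ->; rewrite Qp_abs0 exprz_ge0 // ler0n.
pose a := Qp_of_rat p p%:R^-1 / x.
have xa : x * a = Qp_of_rat p p%:R^-1 by rewrite /a mulrC divfK.
have ax : 0 < Qp_abs x by rewrite lt_neqAle Qp_abs_ge0 andbT eq_sym Qp_abs_eq0.
have ak : Qp_abs a <= p%:R ^ k.
  have [m mE] := Qp_abs_expz x0; move: xk; rewrite mE ler_expz_p // -ltNge => km.
  have := congr1 (@Qp_abs p) xa; rewrite Qp_absM mE Qp_abs_rat pabsqV.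
  rewrite (pabsq_expz p_prime 1) invr_expz opprK => aE.
  have pm : 0 < p%:R ^ m :> rat by rewrite exprz_gt0 // ltr0n prime_gt0.
  (* |x| = p ^ m with m > - k, and |a| = p ^ (1 - m). *)
  rewrite -(ler_pM2l pm) aE -expfzDr ?pnatr_eq0 -?lt0n ?prime_gt0 //.
  by rewrite ler_expz_p //; lia.
have mc := cos_char_measurable x.
have c1 y : `|cos_char x y| <= 1 by rewrite ler_norml cos_le1 cos_geN1.
have ic : mu.-integrable (@pball p k) (EFin \o cos_char x).
  apply: measurable_bounded_integrable => //.
  - by rewrite haar_pball ltry.
  - exact: measurable_funS mc.
  - by exists 1; split => // M M1 y _; exact: le_trans (c1 y) (ltW M1).
have Icv := integrable_fin_num mb ic.
have [I IE] : exists I : R,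
    (\int[mu]_(y in @pball p k) (cos_char x y)%:E = I%:E)%E.
  by exists (fine (\int[mu]_(y in @pball p k) (cos_char x y)%:E)%E); rewrite fineK.
have shI b : Qp_abs b <= p%:R ^ k ->
    (\int[mu]_(y in @pball p k) (cos_char x (y + b))%:E = I%:E)%E.
  by move=> bk; rewrite -IE; exact: haar_integral_shift.
have ish b : Qp_abs b <= p%:R ^ k ->
    mu.-integrable (@pball p k) (fun y => (cos_char x (y + b))%:E).
  move=> bk; apply: measurable_bounded_integrable; first exact: mb.
  - by rewrite haar_pball ltry.
  - apply: measurable_funS (measurableT) (@subsetT _ _) _.
    exact: measurableT_comp mc (@Qp_shift_measurable p b).
  - by exists 1; split => // M M1 y _; exact: le_trans (c1 _) (ltW M1).
have nak : Qp_abs (- a) <= p%:R ^ k by rewrite Qp_absN.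
have : (I%:E + I%:E = (2 * cos_char x a)%:E * I%:E)%E.
  have <- : (\int[mu]_(y in @pball p k)
      ((cos_char x (y + a))%:E + (cos_char x (y + - a))%:E) = I%:E + I%:E)%E.
    rewrite integralD; [|exact: mb|exact: (ish a ak)|exact: (ish _ nak)].
    by rewrite (shI a ak) (shI (- a) nak).
  rewrite -IE -(integralZl mb ic); apply: eq_integral => y _.
  by rewrite -EFinD [RHS]/= -EFinM -cos_char_shift.
rewrite -EFinD -EFinM => -[]; rewrite (cos_char_pinv xa) => E.
rewrite IE; congr (_%:E); apply/eqP/negPn/negP => I0.
move/eqP: cos_2pi_p_neq1; apply.
by apply: (mulIf I0); move: E; lra.
Qed.

End Haar.

(** * Two-sided sums *)

Section symsum.
Variable R : realType.
Implicit Types (F G : int -> R) (a k : int) (N : nat).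

(** The sum of [F n] over [a - N <= n < a + N].  Listing the terms outwards
    from [a] makes the partial sums comparable, which monotone convergence
    needs. *)
Definition symsum a F N : R := \sum_(0 <= i < N) (F (a + i%:Z) + F (a - i.+1%:Z)).

Lemma symsum0 a F : symsum a F 0 = 0.
Proof. by rewrite /symsum big_geq. Qed.

Lemma symsumS a F N :
  symsum a F N.+1 = symsum a F N + (F (a + N%:Z) + F (a - N.+1%:Z)).
Proof. by rewrite /symsum big_nat_recr. Qed.

Lemma symsum_nondecreasing a F : (forall n, 0 <= F n) ->
  {homo symsum a F : n m / (n <= m)%N >-> n <= m}.
Proof.
move=> F0; apply: (homo_leq (@lexx _ _)) => [? ? ?|N]; first exact: le_trans.
by rewrite symsumS lerDl addr_ge0.
Qed.

Lemma symsum_ge0 a F N : (forall n, 0 <= F n) -> 0 <= symsum a F N.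
Proof.
by move=> F0; rewrite -(symsum0 a F); exact: symsum_nondecreasing.
Qed.

Definition jump G (n : int) : R := G n - G (n + 1).

Lemma symsum_telescope a G k N :
  symsum a (fun n => jump G n * (k <= n)%R%:R) N =
  G (Num.min (Num.max k (a - N%:Z)) (a + N%:Z)) - G (a + N%:Z).
Proof.
elim: N => [|N IH].
  have -> : a - 0%:Z = a by lia.
  by rewrite symsum0 (min_idPr _) ?subrr //; lia.
rewrite symsumS IH /jump.
have -> : a - N.+1%:Z + 1 = a - N%:Z by lia.
have -> : a + N%:Z + 1 = a + N.+1%:Z by lia.
set m := Num.min _ _; set m' := Num.min _ _.
have [k1|k1] := leP k (a - N.+1%:Z).
  have -> : k <= a + N%:Z by lia.
  have -> : m = a - N%:Z by lia.
  have -> : m' = a - N.+1%:Z by lia.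
  by rewrite !mulr1; ring.
rewrite mulr0 addr0; have [k2|k2] := leP k (a + N%:Z).
  have -> : m = m' by lia.
  by rewrite mulr1; ring.
have -> : m = a + N%:Z by lia.
have -> : m' = a + N.+1%:Z by lia.
by rewrite mulr0 addr0 !subrr.
Qed.

Lemma symsum_telescope_all a G N :
  symsum a (jump G) N = G (a - N%:Z) - G (a + N%:Z).
Proof.
elim: N => [|N IH]; first by rewrite symsum0 (_ : a - 0%:Z = a + 0%:Z) ?subrr //; lia.
rewrite symsumS IH /jump.
have -> : a - N.+1%:Z + 1 = a - N%:Z by lia.
have -> : a + N%:Z + 1 = a + N.+1%:Z by lia.
by ring.
Qed.

End symsum.

(** * Fourier transform of a radial function *)

(** Here [g] is radial, with value [G n] on the sphere of radius [p ^ n].  The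
    centre [a] of the two-sided sums is left free: in the application it is
    matched to the ball over which the transform is integrated. *)
Section radial_fourier.
Variables (R : realType) (p : nat).
Hypothesis p_prime : prime p.
Variable mu : {measure set (Qp p) -> \bar R}.
Hypothesis mu_haar : is_haar mu.
Variables (a : int) (G : int -> R) (g : Qp p -> R).
Hypothesis G_dec : forall n, G (n + 1) <= G n.
Hypothesis G_ge0 : forall n, 0 <= G n.
Hypothesis G_le1 : forall n, G n <= 1.
Hypothesis G_pinfty : G (a + N%:Z) @[N --> \oo] --> (0 : R).
Hypothesis G_ninfty : G (a - N%:Z) @[N --> \oo] --> g 0.
Hypothesis gE : forall y k, Qp_abs y = p%:R ^ k -> g y = G k.
Hypothesis G_tail : exists C : R, forall i : nat,
  G (a + i%:Z) * p%:R ^ (a + i%:Z) <= C * p%:R ^- i.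
Implicit Types x y : Qp p.

Let c := jump G.
Let c_ge0 n : 0 <= c n. Proof. by rewrite subr_ge0. Qed.
Let pR_gt0 : 0 < p%:R :> R. Proof. by rewrite ltr0n prime_gt0. Qed.
Let pk_ge0 (k : int) : 0 <= p%:R ^ k :> R. Proof. exact/exprz_ge0/ltW. Qed.

(** The superposition of indicators of balls that increases to [g]. *)
Definition step_approx N y : R := symsum a (fun n => c n * \1_(pball n) y) N.

Lemma pball_indic (n : int) y : \1_(pball n) y = (Qp_abs y <= p%:R ^ n)%R%:R :> R.
Proof. by rewrite indicE; congr ((nat_of_bool _)%:R); apply/idP/idP; rewrite inE. Qed.

Lemma step_approx_nondecreasing y :
  {homo step_approx^~ y : n m / (n <= m)%N >-> n <= m}.
Proof. by apply: symsum_nondecreasing => n; rewrite mulr_ge0 // indicE. Qed.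

Lemma step_approx_cvg y : step_approx N y @[N --> \oo] --> g y.
Proof.
rewrite /step_approx; have [->|y0] := eqVneq y 0.
  under eq_fun => N.
    rewrite (_ : symsum _ _ _ = G (a - N%:Z) - G (a + N%:Z)); first over.
    rewrite -symsum_telescope_all; congr symsum; apply/funext => n.
    by rewrite pball_indic Qp_abs0 exprz_ge0 ?mulr1 // ler0n.
  by rewrite -[g 0]subr0; apply: cvgB.
have [k yk] := Qp_abs_expz y0; rewrite (gE yk).
rewrite -[G k]subr0.
apply: (@cvg_trans _ ((G k - G (a + N%:Z)) @[N --> \oo])); last first.
  by apply: cvgB => //; exact: cvg_cst.
apply: near_eq_cvg; exists `|k - a|%N => // N /= kN.
rewrite (_ : symsum _ _ _ = symsum a (fun n => jump G n * (k <= n)%R%:R) N); last first.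
  by congr symsum; apply/funext => n; rewrite pball_indic yk ler_expz_p.
rewrite symsum_telescope (max_idPl _); last by lia.
by rewrite (min_idPl _) //; lia.
Qed.

Lemma step_approx_le N y : 0 <= step_approx N y <= g y.
Proof.
rewrite symsum_ge0 /=; last by move=> n; rewrite mulr_ge0 // indicE.
have cv := @step_approx_cvg y; rewrite -(cvg_lim _ cv) //.
apply: (nondecreasing_cvgn_le (@step_approx_nondecreasing y)).
by apply/cvg_ex; exists (g y).
Qed.

(** The Fourier transform of [step_approx N]. *)
Definition step_fourier N x : R :=
  symsum a (fun n => c n * p%:R ^ n * \1_(pball (- n)) x) N.

Lemma cos_char_bounded x y : `|cos_char R x y| <= 1.
Proof. by rewrite ler_norml cos_le1 cos_geN1. Qed.

Lemma indic_cos_integral n x :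
  mu.-integrable setT (fun y => (cos_char R x y * \1_(pball n) y)%:E) /\
  (\int[mu]_y (cos_char R x y * \1_(pball n) y)%:E)%E =
  (p%:R ^ n * \1_(pball (- n)) x)%:E.
Proof.
have mb := pball_measurable p_prime n.
have rE : (fun y => (cos_char R x y * \1_(pball n) y)%:E) =
    (EFin \o cos_char R x) \_ (pball n).
  apply/funext => y; rewrite patchE indicE; case: ifP => _ /=.
    by rewrite mulr1.
  by rewrite mulr0.
rewrite rE; split; last first.
  by rewrite -integral_mkcond cos_char_integral // pball_indic mulrC.
apply/(integrable_mkcond _ mb).
apply: measurable_bounded_integrable; first exact: mb.
- by rewrite haar_pball // ltry.
- exact: measurable_funS (cos_char_measurable p_prime x).
- exists 1; split => // M M1 y _; exact: le_trans (cos_char_bounded x y) (ltW M1).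
Qed.

Lemma step_integral N x :
  mu.-integrable setT (fun y => (cos_char R x y * step_approx N y)%:E) /\
  (\int[mu]_y (cos_char R x y * step_approx N y)%:E)%E = (step_fourier N x)%:E.
Proof.
rewrite /step_approx /step_fourier; elim: N => [|N [IH1 IH2]].
  have -> : (fun y => (cos_char R x y *
      symsum a (fun n => c n * \1_(pball n) y) 0)%:E) = cst 0%E.
    by apply/funext => y; rewrite symsum0 mulr0.
  by rewrite symsum0 integral0; split=> //; exact: integrable0.
have term n : mu.-integrable setT (fun y => (c n)%:E * (cos_char R x y * \1_(pball n) y)%:E)%E /\
   (\int[mu]_y ((c n)%:E * (cos_char R x y * \1_(pball n) y)%:E))%E =
   (c n * p%:R ^ n * \1_(pball (- n)) x)%:E.
  have [i1 i2] := indic_cos_integral n x; split; first exact: integrableZl.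
  by rewrite integralZl // i2 -EFinM mulrA.
have fE : (fun y => (cos_char R x y *
      symsum a (fun n => c n * \1_(pball n) y) N.+1)%:E) =
  (fun y => (cos_char R x y * symsum a (fun n => c n * \1_(pball n) y) N)%:E +
    ((c (a + N%:Z))%:E * (cos_char R x y * \1_(pball (a + N%:Z)) y)%:E +
     (c (a - N.+1%:Z))%:E * (cos_char R x y * \1_(pball (a - N.+1%:Z)) y)%:E))%E.
  apply/funext => y; rewrite symsumS -!EFinM -!EFinD; congr (_%:E); ring.
have [i1 e1] := term (a + N%:Z); have [i2 e2] := term (a - N.+1%:Z).
have i12 := integrableD measurableT i1 i2.
rewrite fE; split; first exact: (integrableD measurableT IH1 i12).
by rewrite integralD // integralD // IH2 e1 e2 symsumS.
Qed.

Lemma step_approx_measurable N : measurable_fun setT (step_approx N).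
Proof.
have [/measurable_int H _] := step_integral N 0.
apply/measurable_EFinP; apply: eq_measurable_fun H => y _ /=.
by rewrite cos_char_eq1 ?mul1r // mul0r Qp_abs0.
Qed.

Lemma profile_measurable : measurable_fun setT g.
Proof.
apply: (measurable_fun_cvg step_approx_measurable) => y _.
exact: step_approx_cvg.
Qed.

Lemma sum_pinv_le2 N : \sum_(0 <= i < N) (p%:R ^- i : R) <= 2.
Proof.
suff : \sum_(0 <= i < N) (p%:R ^- i : R) <= 2 - 2 * p%:R ^- N.
  move/le_trans; apply; rewrite lerBlDr lerDl.
  by rewrite mulr_ge0 // invr_ge0 exprn_ge0 // ltW.
elim: N => [|N IH]; first by rewrite big_geq // expr0 invr1 mulr1 subrr.
rewrite big_nat_recr //= exprS invfM.
have q0 : 0 <= p%:R ^- N :> R by rewrite invr_ge0 exprn_ge0 // ltW.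
have q2 : p%:R^-1 <= 2^-1 :> R.
  by rewrite lef_pV2 ?posrE // ler_nat prime_gt1.
by have := ler_wpM2r q0 q2; lra.
Qed.

(** At [x = 0] the transform is the integral of [step_approx N]: the bound makes
    [g] integrable, by monotone convergence.  Above the centre the terms are
    controlled by [G_tail], below it by the measure of small balls. *)
Lemma step_fourier0_bounded : exists M : R, forall N, step_fourier N 0 <= M.
Proof.
have [C HC] := G_tail; exists ((C + p%:R ^ a) * 2) => N.
apply: (@le_trans _ _ ((C + p%:R ^ a) * \sum_(0 <= i < N) p%:R ^- i)).
  rewrite mulr_sumr; apply: ler_sum => i _.
  have ind1 n : \1_(pball n) (0 : Qp p) = 1 :> R.
    by rewrite pball_indic Qp_abs0 exprz_ge0 // ler0n.
  rewrite !ind1 !mulr1 [leRHS]mulrDl; apply: lerD.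
    apply: le_trans (HC i); apply: ler_wpM2r => //.
    by rewrite /c /jump lerBlDr lerDl.
  rewrite -[leRHS]mul1r; apply: ler_pM => //.
    by rewrite /c /jump (le_trans _ (G_le1 (a - i.+1%:Z))) // lerBlDr lerDl.
  rewrite exprnN -expfzDr ?gt_eqF //; apply: ler_weXz2l; last by lia.
  by rewrite ler1n prime_gt0.
apply: ler_wpM2l (sum_pinv_le2 N).
rewrite addr_ge0 //; have := HC 0%N; rewrite expr0 invr1 mulr1.
by apply: le_trans; rewrite mulr_ge0.
Qed.

Lemma profile_integrable : mu.-integrable setT (EFin \o g).
Proof.
have g0 y : 0 <= g y by have /andP[] := step_approx_le 0 y; exact: le_trans.
apply/integrableP; split; first by apply/measurable_EFinP; exact: profile_measurable.
under eq_integral do rewrite /= ger0_norm //.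
have [M HM] := step_fourier0_bounded.
apply: (@le_lt_trans _ _ M%:E); last exact: ltry.
have mono y : {homo (fun N => (step_approx N y)%:E) : n m / (n <= m)%N >-> (n <= m)%E}.
  by move=> n m nm; rewrite lee_fin step_approx_nondecreasing.
have := @cvg_monotone_convergence _ _ _ mu setT measurableT
  (fun N y => (step_approx N y)%:E) _ _ (fun y _ => mono y).
have -> : (fun y => limn (fun N => (step_approx N y)%:E)) = (fun y => (g y)%:E).
  apply/funext => y; apply/cvg_lim => //; apply: cvg_EFin; first exact: nearW.
  exact: step_approx_cvg.
move=> H; apply: (cvge_le _ (H _ _)) => [|N|N y _].
- apply: nearW => N; rewrite -[leRHS]/(M%:E).
  have [_ <-]: True /\ (step_fourier N 0)%:E = (\int[mu]_y (step_approx N y)%:E)%E.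
    split=> //; rewrite -(step_integral N 0).2; apply: eq_integral => y _.
    by rewrite cos_char_eq1 ?mul1r // mul0r Qp_abs0.
  by rewrite lee_fin.
- by apply/measurable_EFinP; exact: step_approx_measurable.
- by rewrite lee_fin; have /andP[] := step_approx_le N y.
Qed.

Definition radial_fourier x : R := \int[mu]_y (cos_char R x y * g y).

(** Dominated convergence, with [g] itself as the dominating function. *)
Lemma step_fourier_cvg x : step_fourier N x @[N --> \oo] --> radial_fourier x.
Proof.
have mc := cos_char_measurable (R := R) p_prime x.
have [] := @dominated_convergence _ _ _ mu setT measurableT
  (fun N y => (cos_char R x y * step_approx N y)%:E)
  (fun y => (cos_char R x y * g y)%:E) (EFin \o g).
- move=> N; apply/measurable_EFinP; apply: measurable_funM => //.
  exact: step_approx_measurable.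
- apply/measurable_EFinP; apply: measurable_funM => //; exact: profile_measurable.
- apply: aeW => y _; apply: cvg_EFin; first exact: nearW.
  by apply: cvgMr; exact: step_approx_cvg.
- exact: profile_integrable.
- apply: aeW => y N _; have /andP[s0 sg] := step_approx_le N y.
  rewrite /= lee_fin normrM (ger0_norm s0) -[leRHS]mul1r.
  by apply: ler_pM => //; exact: cos_char_bounded.
move=> fint _; rewrite /radial_fourier /Rintegral.
have ffin := integrable_fin_num measurableT fint.
rewrite -(fineK ffin) => /fine_cvgP[_]; apply: cvg_trans.
apply: near_eq_cvg; apply: nearW => N /=.
by rewrite (step_integral N x).2.
Qed.

Lemma step_fourier_ge0 N x : 0 <= step_fourier N x.
Proof. by apply: symsum_ge0 => n; rewrite !mulr_ge0 // indicE. Qed.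

Lemma step_fourier_nondecreasing x :
  {homo step_fourier^~ x : n m / (n <= m)%N >-> n <= m}.
Proof. by apply: symsum_nondecreasing => n; rewrite !mulr_ge0 // indicE. Qed.

Lemma pball_indic_integral n k :
  (\int[mu]_(x in @pball p k) (\1_(pball n) x)%:E)%E = (p%:R ^ Num.min n k)%:E :> \bar R.
Proof.
rewrite integral_indic; [|exact: pball_measurable..].
rewrite -(haar_pball p_prime mu_haar); congr (mu _); apply/seteqP; split=> x /=; rewrite /pball /=.
  by case: (leP n k) => _ [].
case: (leP n k) => nk H; split=> //; apply: (le_trans H); rewrite ler_expz_p //.
exact: ltW.
Qed.

Lemma step_fourier_measurable N : measurable_fun setT (step_fourier N).
Proof.
rewrite /step_fourier; elim: N => [|N IH].
  by rewrite (_ : (fun=> _) = cst 0) //; apply/funext => x; rewrite symsum0.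
rewrite (_ : (fun=> _) = (fun x => symsum a (fun n => c n * p%:R ^ n * \1_(pball (- n)) x) N +
  (c (a + N%:Z) * p%:R ^ (a + N%:Z) * \1_(pball (- (a + N%:Z))) x +
   c (a - N.+1%:Z) * p%:R ^ (a - N.+1%:Z) * \1_(pball (- (a - N.+1%:Z))) x))); last first.
  by apply/funext => x; rewrite symsumS.
apply: measurable_funD => //; apply: measurable_funD; apply: measurable_funM => //;
  apply: measurable_indic; exact: pball_measurable.
Qed.

Lemma step_fourier_integral N k :
  (\int[mu]_(x in @pball p k) (step_fourier N x)%:E)%E =
  (symsum a (fun n => c n * p%:R ^ n * p%:R ^ Num.min (- n) k) N)%:E.
Proof.
have mb := pball_measurable p_prime k.
elim: N => [|N IH].
  rewrite symsum0; apply: integral0_eq => x _.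
  by rewrite /step_fourier symsum0.
pose t n x : \bar R := (c n * p%:R ^ n * \1_(pball (- n)) x)%:E.
have t0 n x : (0 <= t n x)%E by rewrite lee_fin !mulr_ge0 // indicE.
have mi n : measurable_fun (@pball p k) (fun x => (\1_(@pball p n) x)%:E : \bar R).
  apply/measurable_EFinP; apply: measurable_indic; exact: pball_measurable.
have tE n : t n = (fun x => (c n * p%:R ^ n)%:E * (\1_(pball (- n)) x)%:E)%E.
  by apply/funext => x; rewrite -EFinM.
have mt n : measurable_fun (@pball p k) (t n).
  by rewrite tE; apply: emeasurable_funM => //; exact: measurable_cst.
have tint n : (\int[mu]_(x in @pball p k) t n x)%E =
    (c n * p%:R ^ n * p%:R ^ Num.min (- n) k)%:E.
  rewrite tE ge0_integralZl_EFin ?pball_indic_integral // ?mulr_ge0 //.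
rewrite symsumS.
have -> : (fun x => (step_fourier N.+1 x)%:E) = (fun x => (step_fourier N x)%:E +
    (t (a + N%:Z)%R x + t (a - N.+1%:Z)%R x))%E.
  by apply: funext => x; rewrite /step_fourier symsumS !EFinD.
rewrite ge0_integralD //.
- by rewrite ge0_integralD // IH !tint !EFinD.
- by move=> x _; rewrite lee_fin step_fourier_ge0.
- by apply/measurable_EFinP; exact: measurable_funS (step_fourier_measurable N).
- by move=> x _; rewrite adde_ge0.
- exact: emeasurable_funD.
Qed.

(** The coefficients of [step_fourier N] are nonnegative, so its limit can be
    integrated by monotone convergence. *)
Lemma radial_fourier_ball k L :
  symsum a (fun n => c n * p%:R ^ n * p%:R ^ Num.min (- n) k) N @[N --> \oo] --> L ->
  (\int[mu]_(x in @pball p k) (radial_fourier x)%:E)%E = L%:E.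
Proof.
move=> HL; have mb := pball_measurable p_prime k.
have mono x : {homo (fun N => (step_fourier N x)%:E) : n m / (n <= m)%N >-> (n <= m)%E}.
  by move=> n m nm; rewrite lee_fin step_fourier_nondecreasing.
have := @cvg_monotone_convergence _ _ _ mu _ mb
  (fun N x => (step_fourier N x)%:E) _ _ (fun x _ => mono x).
have -> : (fun x => limn (fun N => (step_fourier N x)%:E)) =
    (fun x => (radial_fourier x)%:E).
  apply/funext => x; apply/cvg_lim => //; apply: cvg_EFin; first exact: nearW.
  exact: step_fourier_cvg.
move=> /(_ _ _)/cvg_lim <- //.
- apply/cvg_lim => //; under eq_fun do rewrite step_fourier_integral.
  by apply: cvg_EFin => //; exact: nearW.
- move=> N; apply/measurable_EFinP.
  exact: measurable_funS (step_fourier_measurable N).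
- by move=> N x _; rewrite lee_fin step_fourier_ge0.
Qed.

End radial_fourier.

(** * Geometric mixtures of exponentials *)

(** [mix u] is the expectation of [expR (- (u * q ^+ i))] when [i] has the
    geometric law of weights [(1 - w) * w ^+ i], and [mix_mean] is that of
    [q ^+ i]. *)
Section geometric_mixture.
Variable R : realType.
Variables w q : R.
Hypothesis w01 : 0 < w < 1.
Hypothesis q01 : 0 < q < 1.
Implicit Types u v : R.

Let w0 : 0 < w. Proof. by case/andP: w01. Qed.
Let w1 : w < 1. Proof. by case/andP: w01. Qed.
Let q0 : 0 < q. Proof. by case/andP: q01. Qed.
Let q1 : q < 1. Proof. by case/andP: q01. Qed.
Let wn0 n : 0 <= w ^+ n. Proof. exact/exprn_ge0/ltW. Qed.
Let qn0 n : 0 <= q ^+ n. Proof. exact/exprn_ge0/ltW. Qed.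
Let qn1 n : q ^+ n <= 1. Proof. by rewrite exprn_ile1 // ltW. Qed.

Lemma expRN_ge v : 1 - v <= expR (- v). Proof. exact: expR_ge1Dx. Qed.

Lemma expRN_le v : 0 <= v -> expR (- v) <= 1 - v + v ^+ 2.
Proof.
move=> v0; rewrite expRN.
have ev : 1 + v <= expR v := expR_ge1Dx v.
have v1 : 0 < 1 + v by lra.
apply: (@le_trans _ _ (1 + v)^-1); first by rewrite lef_pV2 ?posrE ?expR_gt0.
rewrite -div1r ler_pdivrMr //.
have -> : (1 - v + v ^+ 2) * (1 + v) = 1 + v ^+ 3 by ring.
by rewrite lerDl exprn_ge0.
Qed.

Definition mix_partial u N := (1 - w) * \sum_(0 <= i < N) w ^+ i * expR (- (u * q ^+ i)).
Definition mix u : R := limn (mix_partial u).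
Definition mix_mean : R := (1 - w) / (1 - w * q).

Lemma sum_geo (x : R) N : (1 - x) * \sum_(0 <= i < N) x ^+ i = 1 - x ^+ N.
Proof.
elim: N => [|N IH]; first by rewrite big_geq // mulr0 expr0 subrr.
by rewrite big_nat_recr //= mulrDr IH exprS; ring.
Qed.

Lemma mix_partial_nondecreasing u :
  {homo mix_partial u : n m / (n <= m)%N >-> n <= m}.
Proof.
apply: (homo_leq (@lexx _ _)) => [? ? ?|N]; first exact: le_trans.
rewrite /mix_partial big_nat_recr //= mulrDr lerDl.
by rewrite mulr_ge0 ?subr_ge0 ?(ltW w1) // mulr_ge0 // expR_ge0.
Qed.

Lemma mix_partial_le1 u N : 0 <= u -> mix_partial u N <= 1.
Proof.
move=> u0; apply: (@le_trans _ _ (1 - w ^+ N)); last by rewrite gerBl.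
rewrite -sum_geo ler_wpM2l ?subr_ge0 ?(ltW w1) //; apply: ler_sum => i _.
by rewrite ler_piMr // -expR0 ler_expR oppr_le0 mulr_ge0.
Qed.

Lemma mix_cvg u : 0 <= u -> mix_partial u N @[N --> \oo] --> mix u.
Proof.
move=> u0; apply: nondecreasing_is_cvgn; first exact: mix_partial_nondecreasing.
by exists 1 => _ [N _ <-]; exact: mix_partial_le1.
Qed.

Lemma mix_le1 u : 0 <= u -> mix u <= 1.
Proof.
move=> u0; apply: limr_le; first exact: mix_cvg.
by apply: nearW => N; exact: mix_partial_le1.
Qed.

Lemma mix_ge0 u : 0 <= u -> 0 <= mix u.
Proof.
move=> u0; apply: limr_ge; first exact: mix_cvg.
apply: nearW => N; apply: mulr_ge0; first by rewrite subr_ge0 ltW.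
by apply: sumr_ge0 => i _; rewrite mulr_ge0 // expR_ge0.
Qed.

Let mix_lin u N : R := (1 - w ^+ N) - u * (mix_mean * (1 - (w * q) ^+ N)).

Let wq1 : w * q < 1.
Proof. by rewrite (lt_trans _ q1) // gtr_pMl. Qed.

Let mix_linE u N :
  mix_lin u N = (1 - w) * \sum_(0 <= i < N) w ^+ i * (1 - u * q ^+ i).
Proof.
rewrite /mix_lin -!sum_geo /mix_mean [_ / _ * _]mulrA divfK; last first.
  by rewrite gt_eqF // subr_gt0.
rewrite mulrCA -mulrBr mulr_sumr -sumrB; congr (_ * _); apply: eq_bigr => i _.
by rewrite exprMn; ring.
Qed.

Let mix_lin_cvg u : mix_lin u N @[N --> \oo] --> 1 - u * mix_mean.
Proof.
have cw : w ^+ N @[N --> \oo] --> (0 : R).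
  by apply: cvg_expr; rewrite ger0_norm // ltW.
have cwq : (w * q) ^+ N @[N --> \oo] --> (0 : R).
  by apply: cvg_expr; rewrite ger0_norm // mulr_ge0 // ltW.
rewrite -[X in _ --> X - _]subr0 -[in X in _ --> _ - X](mulr1 mix_mean) -[in X in _ --> _ - X](subr0 1).
apply: cvgB; first by apply: cvgB => //; exact: cvg_cst.
apply: cvgMr; apply: cvgMr; apply: cvgB => //; exact: cvg_cst.
Qed.

Lemma mix_ge u : 0 <= u -> 1 - u * mix_mean <= mix u.
Proof.
move=> u0; apply: (ler_cvg_to (@mix_lin_cvg u) (mix_cvg u0)); apply: nearW => N.
rewrite mix_linE ler_wpM2l ?subr_ge0 ?(ltW w1) //; apply: ler_sum => i _.
by rewrite ler_wpM2l // expRN_ge.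
Qed.

Lemma mix_le u : 0 <= u -> mix u <= 1 - u * mix_mean + u ^+ 2.
Proof.
move=> u0.
have cv : mix_lin u N + u ^+ 2 @[N --> \oo] --> 1 - u * mix_mean + u ^+ 2.
  by apply: cvgD; [exact: mix_lin_cvg | exact: cvg_cst].
apply: (ler_cvg_to (mix_cvg u0) cv); apply: nearW => N.
apply: (@le_trans _ _ (mix_lin u N + u ^+ 2 * (1 - w ^+ N))); last first.
  by rewrite lerD2l ler_piMr ?sqr_ge0 // gerBl.
rewrite mix_linE -sum_geo mulrCA -mulrDr ler_wpM2l ?subr_ge0 ?(ltW w1) //.
rewrite mulr_sumr -big_split /=; apply: ler_sum => i _.
rewrite [u ^+ 2 * _]mulrC -mulrDr ler_wpM2l //.
have uq0 : 0 <= u * q ^+ i by rewrite mulr_ge0.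
apply: le_trans (expRN_le uq0) _; rewrite lerD2l exprMn ler_piMr ?sqr_ge0 //.
by rewrite exprn_ile1.
Qed.

Lemma mix_mean01 : 0 <= mix_mean <= 1.
Proof.
have d0 : 0 < 1 - w * q by rewrite subr_gt0.
rewrite divr_ge0 ?subr_ge0 ?(ltW w1) ?(ltW wq1) //=.
by rewrite ler_pdivrMr // mul1r lerB // ler_piMr // ltW.
Qed.

(** Both quantities lie between [1 - u * mix_mean] and
    [1 - u * mix_mean + u ^+ 2]. *)
Lemma mix_near_expR u : 0 <= u -> `|mix u - expR (- (u * mix_mean))| <= u ^+ 2.
Proof.
move=> u0; have /andP[m0 m1] := mix_mean01.
have um0 : 0 <= u * mix_mean by rewrite mulr_ge0.
have := mix_ge u0; have := mix_le u0.
have := expRN_ge (u * mix_mean); have := expRN_le um0.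
have : (u * mix_mean) ^+ 2 <= u ^+ 2.
  by rewrite lerXn2r ?nnegrE // ler_piMr.
rewrite ler_norml => ? ? ? ? ?; apply/andP; split; lra.
Qed.

Lemma dist_exprn_le (x y : R) N : 0 <= x <= 1 -> 0 <= y <= 1 ->
  `|x ^+ N - y ^+ N| <= N%:R * `|x - y|.
Proof.
move=> /andP[x0 x1] /andP[y0 y1]; elim: N => [|N IH].
  by rewrite !expr0 subrr normr0 mul0r.
have -> : x ^+ N.+1 - y ^+ N.+1 = x * (x ^+ N - y ^+ N) + (x - y) * y ^+ N.
  by rewrite !exprS; ring.
apply: le_trans (ler_normD _ _) _; rewrite !normrM -natr1 mulrDl mul1r.
apply: lerD; last by rewrite ler_piMr // ger0_norm ?exprn_ge0 // exprn_ile1.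
apply: le_trans IH; rewrite ler_piMl // ger0_norm //.
Qed.

(** The error [u ^+ 2] is of order [4 ^- n], which beats the [2 ^ n] factors. *)
Lemma mix_pow_cvg v : 0 <= v ->
  mix (v / 2 ^+ n) ^+ (2 ^ n) @[n --> \oo] --> expR (- (v * mix_mean)).
Proof.
move=> v0; apply/cvgrPdist_le => e e0.
have cz : v ^+ 2 * (2^-1) ^+ n @[n --> \oo] --> (0 : R).
  apply: cvg_geometric; rewrite ger0_norm ?invr_ge0 // invf_lt1 //; lra.
near=> n; rewrite distrC.
have z0 : 0 <= v / 2 ^+ n by rewrite divr_ge0 // exprn_ge0.
have -> : expR (- (v * mix_mean)) = expR (- (v / 2 ^+ n * mix_mean)) ^+ (2 ^ n).
  rewrite -expRM_natl; congr expR; rewrite natrX; field.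
  by rewrite expf_neq0.
have /andP[m0 m1] := mix_mean01.
apply: (@le_trans _ _ ((2 ^ n)%:R * (v / 2 ^+ n) ^+ 2)).
  apply: (@le_trans _ _ ((2 ^ n)%:R *
      `|mix (v / 2 ^+ n) - expR (- (v / 2 ^+ n * mix_mean))|)).
    apply: dist_exprn_le; first by rewrite mix_ge0 // mix_le1.
    by rewrite expR_ge0 /= -[leRHS]expR0 ler_expR oppr_le0 mulr_ge0.
  by rewrite ler_wpM2l // mix_near_expR.
have -> : (2 ^ n)%:R * (v / 2 ^+ n) ^+ 2 = v ^+ 2 * (2^-1) ^+ n.
  by rewrite natrX exprVn; field; rewrite expf_neq0.
near: n; move/cvgr_le: cz => /(_ _ e0); exact.
Unshelve. all: end_near. Qed.

End geometric_mixture.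

(** * The heat kernel on balls *)

(** Here [s] stands for the diffusion constant times the elapsed time. *)
Section heat.
Variables (R : realType) (p : nat).
Hypothesis p_prime : prime p.
Variable mu : {measure set (Qp p) -> \bar R}.
Hypothesis mu_haar : is_haar mu.
Variables (b s : R) (r : int).
Hypothesis b_gt0 : 0 < b.
Hypothesis s_gt0 : 0 < s.

Let Q : R := p%:R `^ b.
Let pR_gt0 : 0 < p%:R :> R. Proof. by rewrite ltr0n prime_gt0. Qed.
Let pR_ge0 : 0 <= p%:R :> R. Proof. exact: ltW. Qed.
Let pR_gt1 : 1 < p%:R :> R. Proof. by rewrite ltr1n prime_gt1. Qed.
Let Q_gt0 : 0 < Q. Proof. by rewrite powR_gt0. Qed.
Let Q_gt1 : 1 < Q.
Proof.
rewrite lt_neqAle eq_sym powR_eq1 !negb_or !gt_eqF //= -leNgt pR_ge0 /=.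
by rewrite -[leLHS](powRr0 p%:R) ler_powR // ltW.
Qed.
Let Qz_gt0 n : 0 < Q ^ n. Proof. exact: exprz_gt0. Qed.

Lemma powR_expz (n : int) : (p%:R ^ n) `^ b = Q ^ n :> R.
Proof.
by rewrite -powR_intmul // -powRrM mulrC powRrM powR_intmul // powR_ge0.
Qed.

Lemma prime_inv_itv : 0 < (p%:R^-1 : R) < 1.
Proof. by rewrite invr_gt0 pR_gt0 invf_lt1. Qed.

Lemma prime_powRN_itv : 0 < (p%:R `^ (- b) : R) < 1.
Proof. by rewrite powR_gt0 //= powRN invf_lt1. Qed.

Definition heat_profile (n : int) : R := expR (- (s * Q ^ n)).
Definition heat_symbol (y : Qp p) : R := expR (- (s * padic_norm R y `^ b)).

Lemma heat_profile_dec n : heat_profile (n + 1) <= heat_profile n.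
Proof. by rewrite ler_expR lerN2 ler_pM2l // ler_eXz2l // lerDl. Qed.

Lemma heat_profile_le1 n : heat_profile n <= 1.
Proof. by rewrite -[leRHS]expR0 ler_expR oppr_le0 mulr_ge0 // ltW. Qed.

Let Qinv_cvg : (Q^-1) ^+ N @[N --> \oo] --> (0 : R).
Proof.
apply: cvg_expr; rewrite ger0_norm ?invr_ge0 ?(ltW Q_gt0) //.
by rewrite invf_lt1.
Qed.

Let QzB (a : int) (N : nat) : Q ^ (a - N%:Z) = Q ^ a * (Q^-1) ^+ N.
Proof. by rewrite expfzDr ?gt_eqF // exprVn exprnN. Qed.

Let QzD (a : int) (N : nat) : Q ^ (a + N%:Z) = Q ^ a * Q ^+ N.
Proof. by rewrite expfzDr ?gt_eqF. Qed.

Lemma heat_profile_pinfty (a : int) : heat_profile (a + N%:Z) @[N --> \oo] --> (0 : R).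
Proof.
apply: (@squeeze_cvgr _ _ _ _ (fun=> 0) (fun N => (s * Q ^ a)^-1 * (Q^-1) ^+ N)).
- apply: nearW => N; rewrite expR_ge0 /= /heat_profile expRN exprVn -invfM.
  rewrite lef_pV2 ?posrE ?expR_gt0 ?mulr_gt0 ?exprn_gt0 // -mulrA -QzD.
  by apply: le_trans (expR_ge1Dx _); rewrite lerDr.
- exact: cvg_cst.
- by rewrite -(mulr0 (s * Q ^ a)^-1); apply: cvgMr.
Qed.

Lemma heat_symbol0 : heat_symbol 0 = 1.
Proof.
by rewrite /heat_symbol /padic_norm Qp_abs0 rmorph0 powR0 ?gt_eqF // mulr0 oppr0 expR0.
Qed.

Lemma heat_profile_ninfty (a : int) :
  heat_profile (a - N%:Z) @[N --> \oo] --> heat_symbol 0.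
Proof.
rewrite heat_symbol0 -expR0 -oppr0 -(mulr0 (s * Q ^ a)).
apply: continuous_cvg; first exact: continuous_expR.
apply: cvgN; under eq_fun do rewrite QzB mulrA.
by apply: cvgMr.
Qed.

Lemma heat_symbolE y (k : int) : Qp_abs y = p%:R ^ k -> heat_symbol y = heat_profile k.
Proof.
move=> yk; rewrite /heat_symbol /padic_norm yk fmorphXz /= rmorph_nat.
by rewrite powR_expz.
Qed.

(** Choose [k] with [p ^+ 2 <= Q ^+ k].  Since [expR x >= (x / k) ^+ k], the
    exponential [expR (y * Q ^+ i)] is then at least a constant times
    [p ^+ (2 * i)]. *)
Lemma heat_profile_tail (a : int) : exists C : R, forall i : nat,
  heat_profile (a + i%:Z) * p%:R ^ (a + i%:Z) <= C * p%:R ^- i.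
Proof.
have [k k0 kb] : exists2 k : nat, (0 < k)%N & p%:R ^+ 2 <= Q ^+ k.
  have b2 : 0 <= 2 / b by rewrite divr_ge0 // ltW.
  exists (Num.Def.archi_bound (2 / b)).
    by have := archi_boundP b2; rewrite -(ltr_nat R); apply: le_lt_trans.
  rewrite -[Q ^+ _]powR_mulrn ?(ltW Q_gt0) // -powRrM -powR_mulrn //.
  apply: ler_powR; first exact: ltW.
  by rewrite mulrC -ler_pdivrMr //; exact/ltW/archi_boundP.
pose y := s * Q ^ a.
have y0 : 0 < y by rewrite mulr_gt0.
have kR0 : 0 < k%:R :> R by rewrite ltr0n.
exists (p%:R ^ a * (k%:R / y) ^+ k) => i.
rewrite expfzDr ?gt_eqF // mulrCA -mulrA ler_pM2l ?exprz_gt0 //.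
have pi0 : 0 < p%:R ^+ i :> R by rewrite exprn_gt0.
rewrite ler_pdivlMr // /heat_profile QzD mulrA -/y expRN -mulrA.
rewrite ler_pdivrMl ?expR_gt0 //.
have yk0 : 0 < (y / k%:R) ^+ k by rewrite exprn_gt0 // divr_gt0.
rewrite -invf_div exprVn ler_pdivlMr //.
have -> : y * Q ^+ i = k%:R * (y / k%:R * Q ^+ i) by field; rewrite gt_eqF.
rewrite expRM_natl.
apply: (@le_trans _ _ ((y / k%:R * Q ^+ i) ^+ k)); last first.
  rewrite lerXn2r ?nnegrE ?expR_ge0 //.
    by rewrite mulr_ge0 ?exprn_ge0 ?divr_ge0 // ltW.
  by apply: le_trans (expR_ge1Dx _); rewrite lerDr.
rewrite [leRHS]exprMn [leRHS]mulrC ler_pM2r // -exprM mulnC exprM.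
have -> : p%:R ^ i%:Z * p%:R ^+ i = (p%:R ^+ 2) ^+ i :> R.
  by rewrite expr2 exprMn.
by rewrite lerXn2r ?nnegrE ?exprn_ge0 // ltW.
Qed.

(** The decay exponent [s * |y| ^ b] on the sphere of radius [p ^ (- r)], the
    largest one inside the ball dual to [pball r]. *)
Definition heat_rate : R := s * p%:R `^ (- (r%:~R * b)).

Lemma heat_rate_ge0 : 0 <= heat_rate.
Proof. by rewrite mulr_ge0 ?powR_ge0 // ltW. Qed.

Lemma heat_profile_down (m : nat) :
  heat_profile (- r - m%:Z) = expR (- (heat_rate * (p%:R `^ (- b)) ^+ m)).
Proof.
rewrite /heat_profile QzB; congr (expR (- _)); rewrite mulrA; congr (_ * _ * _).
  by rewrite -mulNr -mulrNz mulrC powRrM powR_intmul // powR_ge0.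
by rewrite powRN.
Qed.

Lemma abel_sum (w : R) (h : nat -> R) N :
  h 0%N + \sum_(0 <= i < N) w ^+ i.+1 * (h i.+1 - h i) =
  (1 - w) * (\sum_(0 <= i < N) w ^+ i * h i) + w ^+ N * h N.
Proof.
elim: N => [|N IH]; first by rewrite !big_geq // mulr0 expr0 mul1r addr0 add0r.
by rewrite !big_nat_recr //= addrA IH !exprS; ring.
Qed.

(** With the two-sided sum centred at [- r], the upper half telescopes: the
    corresponding balls are small enough to lie inside [pball r].  Summation by
    parts turns the lower half into the geometric mixture. *)
Lemma heat_ball_sum_cvg :
  symsum (- r) (fun n => jump heat_profile n * p%:R ^ n * p%:R ^ Num.min (- n) r) N
    @[N --> \oo] --> mix (p%:R^-1) (p%:R `^ (- b)) heat_rate.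
Proof.
pose h m := heat_profile (- r - m%:Z).
have E N : symsum (- r) (fun n => jump heat_profile n * p%:R ^ n * p%:R ^ Num.min (- n) r) N =
  mix_partial (p%:R^-1) (p%:R `^ (- b)) heat_rate N + p%:R^-1 ^+ N * h N -
    heat_profile (- r + N%:Z).
  have -> : mix_partial (p%:R^-1) (p%:R `^ (- b)) heat_rate N =
      (1 - p%:R^-1) * (\sum_(0 <= i < N) p%:R^-1 ^+ i * h i).
    by congr (_ * _); apply: eq_bigr => i _; rewrite /h heat_profile_down.
  rewrite -abel_sum /symsum big_split /=.
  have p0 : p%:R != 0 :> R by rewrite gt_eqF.
  have -> : \sum_(0 <= i < N) (jump heat_profile (- r + i%:Z) * p%:R ^ (- r + i%:Z) *
      p%:R ^ Num.min (- (- r + i%:Z)) r) = h 0%N - heat_profile (- r + N%:Z).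
    rewrite (eq_bigr (fun i : nat => jump heat_profile (- r + i%:Z))) => [|i _].
      elim: N => [|N IH].
        by rewrite big_geq // /h; have -> : - r + 0%:Z = - r - 0%:Z by []; rewrite subrr.
      rewrite big_nat_recr //= IH /jump.
      have -> : - r + N%:Z + 1 = - r + N.+1%:Z by lia.
      by ring.
    rewrite -mulrA -expfzDr //.
    have -> : - r + i%:Z + Num.min (- (- r + i%:Z)) r = 0 by lia.
    by rewrite expr0z mulr1.
  have -> : \sum_(0 <= i < N) (jump heat_profile (- r - i.+1%:Z) * p%:R ^ (- r - i.+1%:Z) *
      p%:R ^ Num.min (- (- r - i.+1%:Z)) r) =
      \sum_(0 <= i < N) p%:R^-1 ^+ i.+1 * (h i.+1 - h i).
    apply: eq_bigr => i _; rewrite -mulrA -expfzDr // mulrC.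
    have -> : - r - i.+1%:Z + Num.min (- (- r - i.+1%:Z)) r = - i.+1%:Z by lia.
    rewrite -exprnN exprVn /jump /h; congr (_ * (_ - heat_profile _)); lia.
  by ring.
have w01 := prime_inv_itv; have q01 := prime_powRN_itv.
have hw : p%:R^-1 ^+ N * h N @[N --> \oo] --> (0 : R).
  apply: (@squeeze_cvgr _ _ _ _ (fun=> 0) (fun N => p%:R^-1 ^+ N)).
  - apply: nearW => N; rewrite mulr_ge0 ?exprn_ge0 ?invr_ge0 ?expR_ge0 //=.
    by rewrite ler_piMr ?heat_profile_le1 // exprn_ge0 // invr_ge0.
  - exact: cvg_cst.
  - apply: cvg_expr; rewrite ger0_norm ?invr_ge0 //; by case/andP: w01.
under eq_fun do rewrite E.
rewrite -[mix _ _ _]addr0 -[mix _ _ _ + 0]subr0.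
apply: cvgB; last exact: heat_profile_pinfty.
by apply: cvgD => //; apply: mix_cvg => //; exact: heat_rate_ge0.
Qed.

Lemma heat_radial_ball :
  (\int[mu]_(x in @pball p r) (radial_fourier mu heat_symbol x)%:E)%E =
  (mix (p%:R^-1) (p%:R `^ (- b)) heat_rate)%:E.
Proof.
apply: (radial_fourier_ball p_prime mu_haar heat_profile_dec) heat_ball_sum_cvg.
- by move=> n; exact: expR_ge0.
- exact: heat_profile_le1.
- exact: heat_profile_pinfty.
- exact: heat_profile_ninfty.
- exact: heat_symbolE.
- exact: heat_profile_tail.
Qed.

Lemma mix_mean_alpha1 : mix_mean (p%:R^-1) (p%:R `^ (- b)) = alpha1 p b :> R.
Proof.
rewrite /mix_mean /alpha1 powRN powRD; last by rewrite (gt_eqF pR_gt0) implybT.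
rewrite powRr1 // -/Q.
have pQ : 1 < Q * p%:R by rewrite (lt_trans Q_gt1) // ltr_pMr.
field; rewrite !gt_eqF ?subr_gt0 //.
Qed.

End heat.

(** * Confined paths and dyadic grids *)

Section paths.
Variables (R : realType) (p : nat).
Hypothesis p_prime : prime p.
Implicit Types (w : skorohod R p) (s t : {nonneg R}).

Lemma coordinate_measurable t (B : set (Qp p)) : measurable B ->
  measurable [set w : skorohod R p | B (w t)].
Proof. by move=> mB; apply: sub_sigma_algebra; exists t, B. Qed.

(** Subtraction on paths is handled by covering Q_p with countably many balls:
    two points differ by an element of [pball r] exactly when some ball of
    radius [p ^ r] with rational centre contains both. *)
Lemma increment_ball_measurable s t (r : int) :
  measurable (@increment R p s t @^-1` pball r).
Proof.
have pr : 0 < p%:R ^ r :> rat by rewrite exprz_gt0 // ltr0n prime_gt0.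
pose C (q : rat) := [set x : Qp p | Qp_abs (x - Qp_of_rat p q) <= p%:R ^ r].
have mC q : measurable (C q) by exact: Qp_ball_translate_measurable.
have -> : @increment R p s t @^-1` pball r =
    \bigcup_(q : rat) ([set w : skorohod R p | C q (w t)] `&` [set w : skorohod R p | C q (w s)]).
  apply/seteqP; split=> [w wst|w [q _ [/= qt qs]]] /=.
    have [q /ltW wq] := Qp_rat_dense (w s) pr.
    exists q => //; split=> //=; rewrite /C /=.
    have -> : w t - Qp_of_rat p q = (w t - w s) + (w s - Qp_of_rat p q) by ring.
    exact: Qp_abs_leD.
  rewrite /pball /increment /=.
  have -> : w t - w s = (w t - Qp_of_rat p q) - (w s - Qp_of_rat p q) by ring.
  by apply: Qp_abs_leD => //; rewrite Qp_absN.
apply: bigcupT_measurable_rat => q.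
by apply: measurableI; apply: coordinate_measurable.
Qed.

Variables (r : int) (T : R).
Hypothesis T_gt0 : 0 < T.

Lemma grid_subproof (n k : nat) : 0 <= k%:R * (T / 2 ^+ n).
Proof. by rewrite mulr_ge0 // divr_ge0 ?exprn_ge0 // ltW. Qed.

Definition grid (n k : nat) : {nonneg R} := NngNum (grid_subproof n k).

Definition confined : set (skorohod R p) :=
  [set w | forall t, t%:num <= T -> pball r (w t)].

Definition grid_confined (n : nat) : set (skorohod R p) :=
  \bigcap_(k in [set k | (k <= 2 ^ n)%N]) [set w | pball r (w (grid n k))].

Lemma grid_confined_measurable n : measurable (grid_confined n).
Proof.
apply: bigcap_measurableType => k _.
by apply: coordinate_measurable; exact: pball_measurable.
Qed.

Lemma gridS (n k : nat) : grid n k = grid n.+1 k.*2.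
Proof.
apply/val_inj => /=; rewrite -muln2 natrM exprS; field.
by rewrite expf_neq0.
Qed.

Lemma grid_confined_nonincreasing :
  {homo grid_confined : n m / (n <= m)%N >-> (m <= n)%O}.
Proof.
have step n : grid_confined n.+1 `<=` grid_confined n.
  move=> w wn k /= kn; rewrite gridS; apply: wn => /=.
  by rewrite expnS -mul2n leq_mul2l.
move=> n m /subnK <-; rewrite subsetEset.
by elim: (m - n)%N => // l IH; exact: subset_trans (step _) IH.
Qed.

Lemma dyadic_between (t d : R) : 0 <= t -> t < T -> 0 < d ->
  exists n k : nat, [/\ (k <= 2 ^ n)%N, t < k%:R * (T / 2 ^+ n) &
    k%:R * (T / 2 ^+ n) < t + d].
Proof.
move=> t0 tT d0; pose e := Num.min d (T - t).
have e0 : 0 < e by rewrite lt_min d0 subr_gt0.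
pose n := Num.Def.archi_bound (T / e).
have n2 : T / 2 ^+ n < e.
  rewrite ltr_pdivrMr ?exprn_gt0 // mulrC -ltr_pdivrMr //.
  have Te : 0 <= T / e by rewrite divr_ge0 // ltW.
  apply: lt_trans (archi_boundP Te) _.
  by rewrite -natrX ltr_nat ltn_expl.
have h0 : 0 < T / 2 ^+ n by rewrite divr_gt0 // exprn_gt0.
set h := T / 2 ^+ n in n2 h0 *.
have th : 0 <= t / h by rewrite divr_ge0 // ltW.
pose k := Num.Def.truncn (t / h).
have [k1 k2] : k%:R * h <= t /\ t < k.+1%:R * h.
  rewrite -ler_pdivlMr // -ltr_pdivrMr //.
  by have /andP[] := truncn_itv th.
have kd : k.+1%:R * h < t + e by rewrite -natr1 mulrDl mul1r; lra.
have ed : e <= d by rewrite ge_min lexx.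
have eT : e <= T - t by rewrite ge_min lexx orbT.
exists n, k.+1; split=> //; last by rewrite -/h; lra.
have : k.+1%:R * h < T by lra.
by rewrite /h mulrA ltr_pdivrMr ?exprn_gt0 // mulrC ltr_pM2l // -natrX ltr_nat => /ltnW.
Qed.

(** Let the path be in the ball at all dyadic times and let [t < T].  By
    right-continuity the path moves by less than [p ^ r] between [t] and some
    dyadic time slightly larger than [t], so it is in the ball at time [t] too.
    At [t = T], which is a dyadic time, right-continuity would not help. *)
Lemma confinedE : confined = \bigcap_n grid_confined n.
Proof.
apply/seteqP; split=> [w wT n _ k /= kn|w wn t].
  apply: wT => /=; rewrite mulrA ler_pdivrMr ?exprn_gt0 // mulrC ler_pM2l //.
  by rewrite -natrX ler_nat.
rewrite le_eqVlt => /orP[/eqP tT|tT].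
  have -> : t = grid 0 1 by apply/val_inj; rewrite /= tT expr0 divr1 mul1r.
  exact: wn.
have pr : 0 < p%:R ^ r :> rat by rewrite exprz_gt0 // ltr0n prime_gt0.
have [cv _] := path_cadlag w t.
have := cv _ (@nbhsx_ballx rat (Qp p) (w t) _ pr).
rewrite /= => /(@nbhs_ballP R R)[d /= d0 Hd].
have [|n [k [kn tk kd]]] := @dyadic_between t%:num d _ tT d0; first by [].
have := Hd (grid n k)%:num; rewrite /ball /= => /(_ _ tk).
have -> : extend_path w (k%:R * (T / 2 ^+ n)) = w (grid n k).
  rewrite /extend_path; congr (w _); apply/val_inj => /=.
  by apply/max_idPr; exact: grid_subproof.
rewrite ltr_distlC => /(_ _)/ltW wtk.
rewrite /pball /= -(subrK (w (grid n k)) (w t)); apply: Qp_abs_leD.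
  by apply: wtk; apply/andP; split; lra.
exact: wn.
Qed.

Lemma confined_measurable : measurable confined.
Proof.
rewrite confinedE; apply: bigcapT_measurable => n.
exact: grid_confined_measurable.
Qed.

End paths.

(** * Confinement probability of Brownian motion *)

Section brownian.
Variables (R : realType) (p : nat).
Hypothesis p_prime : prime p.
Variable mu : {measure set (Qp p) -> \bar R}.
Hypothesis mu_haar : is_haar mu.
Variables (sigma b : R) (r : int) (T : R).
Hypothesis sigma_gt0 : 0 < sigma.
Hypothesis b_gt0 : 0 < b.
Hypothesis T_gt0 : 0 < T.
Variable P : probability (skorohod R p) R.
Hypothesis P_brownian : is_brownian mu sigma b P.

Let F := mix (p%:R^-1 : R) (p%:R `^ (- b)).

(** Only the real part of the law of the increment is used. *)
Lemma increment_ball_prob (s t : {nonneg R}) : s%:num < t%:num ->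
  P (increment s t @^-1` pball r) =
    (F (heat_rate p b (sigma * (t%:num - s%:num)) r))%:E.
Proof.
move=> st; have mI := increment_ball_measurable p_prime s t r.
have ts0 : 0 < sigma * (t%:num - s%:num) by rewrite mulr_gt0 // subr_gt0.
rewrite -(fineK (fin_num_measure P _ mI)); congr (_%:E).
have := brownian_law P_brownian st (pball_measurable p_prime r).
rewrite /complex_integral => /(congr1 (@complex.Re R)) /= ->.
rewrite /Rintegral -[RHS]/(fine (F _)%:E) /F -(heat_radial_ball p_prime mu_haar r b_gt0 ts0).
congr (fine _); apply: eq_integral => x _; congr (_%:E).
rewrite /heat_kernel /complex_integral /= /radial_fourier.
apply: eq_Rintegral => y _.
by rewrite /padic_char /cos_char /heat_symbol /= mulr0 subr0.
Qed.

Definition grid_increments (n : nat) : set (skorohod R p) :=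
  \bigcap_(i in [set: 'I_(2 ^ n)])
    increment (grid T_gt0 n i) (grid T_gt0 n i.+1) @^-1` pball r.

Lemma grid_increments_prob n :
  P (grid_increments n) =
    (F (heat_rate p b (sigma * T) r / 2 ^+ n) ^+ (2 ^ n))%:E.
Proof.
have h0 : 0 < T / 2 ^+ n by rewrite divr_gt0 // exprn_gt0.
rewrite (brownian_indep P_brownian (n := 2 ^ n) (s := fun i => grid T_gt0 n i)
  (t := fun i => grid T_gt0 n i.+1) _ _ (fun=> pball_measurable p_prime r)).
- rewrite (eq_bigr (fun=> (F (heat_rate p b (sigma * T) r / 2 ^+ n))%:E)); last first.
    move=> i _; rewrite increment_ball_prob /=; last by rewrite ltr_pM2r // ltr_nat.
    congr (_%:E); congr F; rewrite /heat_rate -natr1; ring.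
  by rewrite prodEFin prodr_const card_ord.
- by move=> i /=; rewrite ltr_pM2r // ltr_nat.
- move=> i j ij /=; rewrite !ler_pM2r // !ler_nat.
  by case: (ltngtP i j) ij => [||/val_inj ->]; [left|right|rewrite eqxx].
Qed.

Lemma grid_increments_measurable n : measurable (grid_increments n).
Proof.
apply: fin_bigcap_measurable => // i _; exact: increment_ball_measurable.
Qed.

Let Z : set (skorohod R p) := [set w | w 0%:nng = 0].

Lemma start_measurable : measurable Z.
Proof. exact: (coordinate_measurable _ (@Qp_set1_measurable p 0)). Qed.

Lemma prob_start (A : set (skorohod R p)) : measurable A -> P (A `&` Z) = P A.
Proof.
move=> mA; have mZ := start_measurable.
rewrite [RHS](measureDI _ mA mZ) [X in _ = (X + _)%E](_ : _ = 0%E) ?add0e //.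
have ZC : P (~` Z) = 0%E.
  by rewrite probability_setC // (brownian_start P_brownian) subee.
apply/eqP; rewrite -measure_le0 -ZC; apply: le_measure; rewrite ?inE.
- exact: measurableD.
- exact: measurableC.
- by move=> w [].
Qed.

(** The ball is a subgroup: partial sums of increments in it stay in it, and
    conversely. *)
Lemma grid_start n : grid_confined r T_gt0 n `&` Z = grid_increments n `&` Z.
Proof.
have g0 : grid T_gt0 n 0 = 0%:nng by apply/val_inj; rewrite /= mul0r.
apply/seteqP; split=> w [wn w0]; split=> //.
  move=> i _ /=; rewrite /pball /increment /=; apply: Qp_abs_leD.
    by apply: wn => /=.
  by rewrite Qp_absN; apply: wn => /=; exact: ltnW.
move=> k; rewrite /=; elim: k => [_|k IH kn].
  rewrite g0 w0 /pball /= Qp_abs0 exprz_ge0 // ler0n.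
rewrite /pball /= -(subrK (w (grid T_gt0 n k)) (w _)); apply: Qp_abs_leD.
  exact: (wn (Ordinal kn)).
by apply: IH; exact: ltnW.
Qed.

Lemma grid_confined_prob n : P (grid_confined r T_gt0 n) =
  (F (heat_rate p b (sigma * T) r / 2 ^+ n) ^+ (2 ^ n))%:E.
Proof.
rewrite -grid_increments_prob -(prob_start (grid_confined_measurable p_prime r T_gt0 n)).
by rewrite grid_start prob_start //; exact: grid_increments_measurable.
Qed.

Lemma confined_prob : P (confined r T) =
  (expR (- (sigma * alpha1 p b * T * p%:R `^ (- (r%:~R * b)))))%:E.
Proof.
have w01 := prime_inv_itv R p_prime; have q01 := prime_powRN_itv p_prime b_gt0.
have v0 : 0 <= heat_rate p b (sigma * T) r.
  by apply: heat_rate_ge0; rewrite mulr_gt0.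
have lim1 : P (grid_confined r T_gt0 n) @[n --> \oo] --> P (confined r T).
  rewrite (confinedE p_prime r T_gt0).
  apply: nonincreasing_cvg_mu.
  - by rewrite (le_lt_trans (probability_le1 _ _)) ?ltry //; exact: grid_confined_measurable.
  - by move=> n; exact: grid_confined_measurable.
  - by rewrite -(confinedE p_prime); exact: confined_measurable.
  - exact: grid_confined_nonincreasing.
have lim2 : P (grid_confined r T_gt0 n) @[n --> \oo] -->
    (expR (- (heat_rate p b (sigma * T) r * mix_mean (p%:R^-1) (p%:R `^ (- b)))))%:E.
  under eq_fun do rewrite grid_confined_prob.
  apply: cvg_EFin; first exact: nearW.
  exact: (mix_pow_cvg w01 q01 v0).
rewrite (cvg_unique _ lim1 lim2) // mix_mean_alpha1 //.
by congr (expR _)%:E; rewrite /heat_rate; ring.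
Qed.

End brownian.

Theorem theorem4p1 (R : realType) (p d : nat) (sigma b : R)
  (p_prime : prime p) (d_ge1 : (1 <= d)%N) (sigma_gt0 : 0 < sigma)
  (b_gt0 : 0 < b)
  (mu : {measure set (Qp p) -> \bar R}) (mu_haar : is_haar mu)
  (P : probability (skorohod R p) R) (P_brownian : is_brownian mu sigma b P)
  (Pd : probability (d.-tuple (skorohod R p)) R)
  (Pd_power : is_power_measure P Pd)
  (r : int) (T : R) (T_gt0 : 0 < T) :
  Pd [set w | (ereal_sup [set (max_norm R (product_process t w))%:E
                         | t in [set t : {nonneg R} | (t%:num <= T)%R]]
               <= (p%:R ^ r)%:E)%E]
  = (expR (- (d%:R * sigma * alpha1 p b * T * p%:R `^ (- (r%:~R * b)))))%:E.
Proof.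
have pr : 0 <= p%:R ^ r :> R by rewrite exprz_ge0 // ler0n.
have normE (x : Qp p) : (padic_norm R x <= p%:R ^ r) = (Qp_abs x <= p%:R ^ r).
  by rewrite /padic_norm -[RHS](ler_rat R) fmorphXz /= rmorph_nat.
have -> : [set w | (ereal_sup [set (max_norm R (product_process t w))%:E
      | t in [set t : {nonneg R} | (t%:num <= T)%R]] <= (p%:R ^ r)%:E)%E] =
    [set w : d.-tuple (skorohod R p) | forall i, confined r T (tnth w i)].
  apply/seteqP; split=> [w /= wT i t tT|w /= wT].
    have /= : ((max_norm R (product_process t w))%:E <= (p%:R ^ r)%:E)%E.
      by apply: le_trans wT; apply: ereal_sup_ubound; exists t.
    rewrite lee_fin => /bigmax_leP[_ /(_ i isT)].
    by rewrite mxE normE.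
  apply: ge_ereal_sup => _ [t /= tT <-]; rewrite lee_fin.
  by apply/bigmax_leP; split=> // i _; rewrite mxE normE; exact: wT.
rewrite (Pd_power (fun=> confined r T)); last first.
  by move=> _; exact: (confined_measurable p_prime r T_gt0).
rewrite (eq_bigr _ (fun i _ => confined_prob p_prime mu_haar r sigma_gt0 b_gt0 T_gt0 P_brownian)).
rewrite prodEFin prodr_const card_ord -expRM_natl; congr (expR _)%:E; ring.
Qed.
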